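(* Let $b\in BMO(\mathbb R^n)$, and let $[b,\mathcal T]$ be a linear or sublinear operator such that, for some absolute constant $c_2$, for every $f\in L^1(\mathbb R^n)$ with compact support and every $x\notin \mathrm{supp}\, f$, $$\big|[b,\mathcal T](f)(x)\big|\leq c_2\int_{\mathbb R^n}\frac{|b(x)-b(y)|\cdot|f(y)|}{|x-y|^n}\,dy .$$ Let $\Theta$ be a positive increasing function on $(0,+\infty)$ satisfying $\Theta(2r)\le D(\Theta)\,\Theta(r)$ for all $r>0$, with a constant $0<D(\Theta)<2^n$. Let $\Phi(t)=t(1+\log^+t)$. Suppose that there is a constant $C_0$, depending only on $n$, $D(\Theta)$ and $\|b\|_*$, such that for every $\sigma>0$ and every $f\in L^1(\mathbb R^n)$ with compact support, $$\big|\{x\in\mathbb R^n:|[b,\mathcal T](f)(x)|>\sigma\}\big|\leq C_0\int_{\mathbb R^n}\Phi\left(\frac{|f(x)|}{\sigma}\right)dx .$$ Then there exists a constant $C>0$ such that for every $f\in L^1(\mathbb R^n)$ with compact support, every $\sigma>0$ and every ball $B(x_0,r)\subset\mathbb R^n$, $$\frac{1}{\Theta(r)}\,\big|\{x\in B(x_0,r):|[b,\mathcal T](f)(x)|>\sigma\}\big|\leq C\sup_{B(y_0,\rho)}\frac{1}{\Theta(\rho)}\int_{B(y_0,\rho)}\Phi\left(\frac{|f(x)|}{\sigma}\right)dx ,$$ where the supremum is over all balls $B(y_0,\rho)$, $y_0\in\mathbb R^n$, $\rho>0$ (the constant $C$ is independent of $f$, $B(x_0,r)$ and $\sigma$).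
   Context: The symbol $[b,\mathcal T]$ is the name of an abstract operator mapping functions $f$ to measurable functions on $\mathbb R^n$; only the properties listed in the claim are assumed. Sublinear means in particular $|[b,\mathcal T](f+g)|\le |[b,\mathcal T](f)|+|[b,\mathcal T](g)|$. $B(x_0,r)$ is the open ball with center $x_0$ and radius $r$, and $|E|$ is Lebesgue measure. $BMO(\mathbb R^n)$ is the space of locally integrable $b$ with $\|b\|_*=\sup_B\frac1{|B|}\int_B|b(x)-b_B|\,dx<\infty$, where $b_B=\frac1{|B|}\int_B b$. $\log^+t=\max(\log t,0)$, with $\Phi(0)=0$. The right-hand side may be infinite. *)

(* Defs.v *)
From HB Require Import structures.
From mathcomp Require Export all_boot all_order all_algebra.
From mathcomp Require Export all_classical all_reals all_analysis.
Export numFieldNormedType.Exports.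
Export Order.TTheory GRing.Theory Num.Theory.

Set Implicit Arguments.
Unset Strict Implicit.
Unset Printing Implicit Defensive.

Local Open Scope classical_set_scope.
Local Open Scope ring_scope.

(* The dimension is written [n.+1], so that it is at least 1.  The topology of
   ['rV[R]_n.+1] in the library is that of the Euclidean space, but the
   library's norm and balls on this type are those of the sup norm; the
   Euclidean norm and balls are therefore defined here. *)

Section euclidean.
Context (R : realType) (n : nat).
Implicit Types x y : 'rV[R]_n.+1.

Definition enorm x : R := Num.sqrt (\sum_i (x 0 i) ^+ 2).

Definition eball x (r : R) : set 'rV[R]_n.+1 := [set y | enorm (y - x) < r].

End euclidean.

(* The library has Lebesgue measure only on the real line.  On R^n it is
   obtained from the outer measure given by countable covers by half-open boxes,
   through the library's Caratheodory theorem; the measurable sets are thus all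
   the Lebesgue measurable sets. *)

Section lebesgue_measure_Rn.
Context (R : realType) (n : nat).
Implicit Types (a b : 'rV[R]_n.+1) (A : set 'rV[R]_n.+1).
Local Open Scope ereal_scope.

Definition box a b : set 'rV[R]_n.+1 :=
  [set x | forall i, x 0%R i \in `]a 0%R i, b 0%R i]%R].

Definition box_volume a b : R := (\prod_i (b 0 i - a 0 i))%R.

(* Boxes with [a 0 i = b 0 i] are empty and have volume 0, so finite covers are
   included. *)
Definition box_cover A (a b : nat -> 'rV[R]_n.+1) : Prop :=
  (forall k i, (a k 0 i <= b k 0 i)%R) /\
  A `<=` \bigcup_k box (a k) (b k).

Definition lebesgue_outer A : \bar R :=
  ereal_inf [set v | exists a b : nat -> 'rV[R]_n.+1, box_cover A a b /\
    v = \sum_(k <oo) (box_volume (a k) (b k))%:E].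

Let box_volume_ge0 a b :
  (forall i, (a 0 i <= b 0 i)%R) -> (0 <= box_volume a b)%R.
Proof. by move=> ab; apply: prodr_ge0 => i _; rewrite subr_ge0. Qed.

Let lebesgue_outer_ge0 A : 0 <= lebesgue_outer A.
Proof.
apply: le_ereal_inf_tmp => _ [a [b [[ab _] ->]]].
by apply: nneseries_ge0 => k _ _; rewrite lee_fin box_volume_ge0.
Qed.

Let lebesgue_outer0 : lebesgue_outer set0 = 0.
Proof.
apply/eqP; rewrite eq_le lebesgue_outer_ge0 andbT.
apply: ereal_inf_lbound; exists (fun=> 0%R), (fun=> 0%R); split; first by split.
by rewrite eseries0// => k _ _; rewrite /box_volume big_ord_recl subrr mul0r.
Qed.

Let lebesgue_outer_sigma_subadditive A (F : nat -> set 'rV[R]_n.+1) :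
  A `<=` \bigcup_i F i -> lebesgue_outer A <= \sum_(i <oo) lebesgue_outer (F i).
Proof.
move=> AF; have [[i ioo]|] := pselect (exists i, lebesgue_outer (F i) = +oo).
  rewrite (eseries_pinfty _ _ ioo) ?leey// => k _.
  by rewrite -ltNye (lt_le_trans _ (lebesgue_outer_ge0 _)).
rewrite -forallNE => Foo; apply/lee_addgt0Pr => e e0.
rewrite (le_trans _ (epsilon_trick _ _ (ltW e0)))//.
pose T := (nat -> 'rV[R]_n.+1)%type.
pose P i (c : T * T) := box_cover (F i) c.1 c.2 /\
  \sum_(k <oo) (box_volume (c.1 k) (c.2 k))%:E <=
    lebesgue_outer (F i) + (e / (2 ^ i.+1)%:R)%:E.
have [G PG] : {G & forall i, P i (G i)}.
  apply: (@choice _ _ P) => i.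
  have Ffin : lebesgue_outer (F i) \is a fin_num.
    by rewrite ge0_fin_numE// ltey; apply/eqP/Foo.
  have en1 : (0 < e / (2 ^ i.+1)%:R)%R by rewrite divr_gt0// ltr0n expn_gt0.
  have [_ [a [b [abF ->]]] /ltW abe] := lb_ereal_inf_adherent en1 Ffin.
  by exists (a, b).
pose v i j : \bar R := (box_volume ((G i).1 j) ((G i).2 j))%:E.
have v0 i j : 0 <= v i j.
  by rewrite lee_fin box_volume_ge0// => k; exact: (PG i).1.1.
apply: (@le_trans _ _ (\esum_(p in setT) v p.1 p.2)).
  have /card_esym/ppcard_eqP[f] := card_nat2.
  apply: ereal_inf_lbound.
  exists (fun k => (G (f k).1).1 (f k).2), (fun k => (G (f k).1).2 (f k).2).
  split.
    split=> [k j|t /AF[i _ /(PG i).1.2[j _ tij]]]; first exact: (PG _).1.1.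
    by exists (f^-1%FUN (i, j)) => //=; rewrite invK ?inE.
  rewrite (reindex_esum [set: nat] setT f); last exact: 'bij_f.
  by rewrite -(@nneseries_esumT _ (fun k => v (f k).1 (f k).2)).
rewrite (_ : esum _ _ = \sum_(i <oo) \sum_(j <oo) v i j).
  apply: lee_nneseries => [i _ _|i _]; last exact: (PG i).2.
  exact: nneseries_ge0.
rewrite nneseries_esumT => [|i]; last exact: nneseries_ge0.
rewrite (eq_esum (fun i _ => nneseries_esumT (v0 i))).
rewrite esum_esum//; congr esum.
by apply/seteqP; split.
Qed.

HB.instance Definition _ := isSubsetOuterMeasure.Build R 'rV[R]_n.+1
  lebesgue_outer lebesgue_outer0 lebesgue_outer_ge0
  lebesgue_outer_sigma_subadditive.

HB.instance Definition _ := @isMeasurable.Build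
  (caratheodory_display lebesgue_outer) 'rV[R]_n.+1
  (caratheodory_measurable lebesgue_outer)
  (caratheodory_measurable_set0 lebesgue_outer)
  (@caratheodory_measurable_setC _ _ lebesgue_outer)
  (@caratheodory_measurable_bigcup _ _ lebesgue_outer).

Definition lebesgue : set 'rV[R]_n.+1 -> \bar R := lebesgue_outer.

HB.instance Definition _ := isMeasure.Build _ _ _ lebesgue
  (@caratheodory_measure0 _ _ lebesgue_outer)
  (@caratheodory_measure_ge0 _ _ lebesgue_outer)
  (@caratheodory_measure_sigma_additive _ _ lebesgue_outer).

End lebesgue_measure_Rn.
Arguments lebesgue {R n}.

Section function_classes.
Context (R : realType) (n : nat).
Implicit Types f g b : 'rV[R]_n.+1 -> R.
Local Notation mu := (@lebesgue R n).

Definition supp f : set 'rV[R]_n.+1 := closure [set x | f x != 0].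

Definition L1c f : Prop :=
  mu.-integrable setT (EFin \o f) /\ compact (supp f).

Definition locally_integrable_Rn b : Prop :=
  measurable_fun setT b /\
  forall K : set 'rV[R]_n.+1, compact K -> mu.-integrable K (EFin \o b).

Definition ball_mean b (x : 'rV[R]_n.+1) (r : R) : R :=
  (fine (mu (eball x r)))^-1 * \int[mu]_(y in eball x r) b y.

Definition bmo_norm b : \bar R :=
  ereal_sup [set v | exists (x : 'rV[R]_n.+1) (r : R), 0 < r /\
    v = ((fine (mu (eball x r)))^-1%:E *
         \int[mu]_(y in eball x r) `|b y - ball_mean b x r|%:E)%E].

Definition BMO b : Prop := locally_integrable_Rn b /\ (bmo_norm b < +oo)%E.

End function_classes.

Definition logplus (R : realType) (t : R) : R := Num.max (ln t) 0.

(* [Phi 0 = 0] because of the factor [t]. *)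
Definition Phi (R : realType) (t : R) : R := t * (1 + logplus t).

Section operators.
Context (R : realType) (n : nat).
Implicit Types T : ('rV[R]_n.+1 -> R) -> 'rV[R]_n.+1 -> R.
Local Notation mu := (@lebesgue R n).

(* The operators of this section are only constrained on integrable functions
   with compact support. *)

Definition linear_op T : Prop :=
  forall (a : R) f g, L1c f -> L1c g -> forall x,
    T (fun y => a * f y + g y) x = a * T f x + T g x.

Definition sublinear_op T : Prop :=
  forall f g, L1c f -> L1c g -> forall x,
    `|T (fun y => f y + g y) x| <= `|T f x| + `|T g x|.

(* The integrand has the value 0 at [y = x], by the convention [0^-1 = 0]. *)
Definition commutator_size_bound (b : 'rV[R]_n.+1 -> R) T (c : R) : Prop :=
  forall f, L1c f -> forall x, ~ supp f x ->
    (`|T f x|%:E <= c%:E *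
      \int[mu]_y (`|b x - b y| * `|f y| / enorm (x - y) ^+ n.+1)%:E)%E.

End operators.

(* The generalized Morrey norm of [Phi (|f| / sigma)]; possibly [+oo]. *)
Definition morrey_Phi (R : realType) (n : nat) (Theta : R -> R)
    (f : 'rV[R]_n.+1 -> R) (sigma : R) : \bar R :=
  ereal_sup [set v | exists (y : 'rV[R]_n.+1) (rho : R), 0 < rho /\
    v = ((Theta rho)^-1%:E *
         \int[lebesgue]_(x in eball y rho) (Phi (`|f x| / sigma))%:E)%E].

(* Main.v *)
Require Import Defs.
From mathcomp Require Import all_boot all_order all_algebra.
From mathcomp Require Import all_classical all_reals all_analysis.
From mathcomp Require Import measurable_realfun ring lra.

Set Implicit Arguments.
Unset Strict Implicit.
Unset Printing Implicit Defensive.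

Local Open Scope classical_set_scope.
Local Open Scope ring_scope.

(** Fix a ball [B] of centre [x0] and radius [r], write [2^k B] for its
    dilations, [N] for the dimension [n.+1], [g] for [|f| / sigma] and [m] for the
    Morrey supremum, so that the integral of [Phi g] over [2^k B] is at most
    [Theta (2^k r) * m <= D^k * Theta r * m].  Split [f] into [f1], its
    restriction to [2 B], and [f2].  The contribution of [f1] is controlled by
    the global weak estimate and [Phi (2 t) <= 4 Phi t].

    On [B] the size condition bounds [|T f2 x|] by a sum over the dyadic rings
    of [(2^k r)^-N] times the integral over [2^(k+2) B] of [|b x - b y| |f y|]
    ([far_integral_le]).  There [|b x - b y|] is at most
    [|b x - m_0| + (k + 2) L + |m_(k+2) - b y|], where [m_k] is a mean value of
    [b] attached to [2^k B] and consecutive ones differ by at most [L].  The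
    first two terms multiply the integral of [g <= Phi g], and the decay
    [(D / 2^N)^k] of [D^k / (2^k)^N] makes the series converge: this is where
    [D < 2^N] is used.  The last term is a product of a function with
    exponentially integrable oscillation and of a function in [L log L].

    Duality of Orlicz norms does not suffice for that term, because the
    [L log L] norm of [g] is not bounded by a multiple of the mean of [Phi g]:
    a logarithm is lost when this mean is small.  Young's inequality with a
    free parameter [a] ([young_LlogL]) takes its place: the product is at most
    [(a + C) Phi g + C exp (- ga a / 4) exp (ga |b - m_k|)].  Summing with
    [a + k] in place of [a] gives ([far_bound]), with
    [tau = Theta r * m / r^N],
    [|T f2 x| <= C sigma (tau (|b x - m_0| + A (1 + a)) + exp (- ga a / 4))].
    Choose [a] so large that the exponential term is at most [sigma / 8], then
    [eps] so small that [tau <= eps] makes the middle term at most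
    [sigma / 8].  If [tau > eps], the measure of [B] itself is at most a
    constant times [Theta r * m].  If [tau <= eps], the set where
    [|T f2| > sigma / 2] lies in the set where [C tau |b x - m_0| >= 1/4], whose
    measure in [B] is at most a constant times [tau r^N = Theta r * m] by
    Chebyshev's inequality ([weak_estimate_ball]).

    The exponential integrability is the John-Nirenberg inequality
    ([john_nirenberg]), proved for cubes by a stopping time on dyadic cells.
    The Lebesgue differentiation theorem that the argument usually rests on is
    replaced by a weaker fact that follows from the definition of the outer
    measure by covers: a set of finite measure that fills at most half of each
    dyadic cell that it meets is null ([half_density_null]). *)

(** * The Euclidean norm *)

Section enorm_theory.
Context (R : realType) (n : nat).
Implicit Types x y : 'rV[R]_n.+1.

Lemma enorm_ge0 x : 0 <= enorm x.
Proof. exact: sqrtr_ge0. Qed.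

Lemma sqr_enorm x : enorm x ^+ 2 = \sum_i x 0 i ^+ 2.
Proof. by rewrite sqr_sqrtr// sumr_ge0// => i _; rewrite sqr_ge0. Qed.

Lemma coord_le_enorm x i : `|x 0 i| <= enorm x.
Proof.
rewrite -sqrtr_sqr ler_wsqrtr// (bigD1 i)//= lerDl.
by rewrite sumr_ge0// => j _; rewrite sqr_ge0.
Qed.

Lemma enorm_le_coord x (d : R) : 0 <= d ->
  (forall i, `|x 0 i| <= d) -> enorm x <= n.+1%:R * d.
Proof.
move=> d0 xd; rewrite -(ler_pXn2r (ltn0Sn 1)) ?nnegrE ?enorm_ge0 ?mulr_ge0//.
rewrite sqr_enorm (@le_trans _ _ (\sum_(i < n.+1) d ^+ 2))//.
  apply: ler_sum => i _.
  by rewrite -(real_normK (num_real (x 0 i))) ler_pXn2r// nnegrE.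
rewrite sumr_const card_ord -[leLHS]mulr_natl exprMn ler_wpM2r ?sqr_ge0//.
by rewrite expr2 ler_peMr// ler1n.
Qed.

(** The square of [enorm (t *: x - y)] is a nonnegative quadratic polynomial
    in [t]; Cauchy-Schwarz is its value at the minimum. *)
Lemma enorm_cauchy_schwarz x y : \sum_i x 0 i * y 0 i <= enorm x * enorm y.
Proof.
have Cge0 (t : R) : 0 <= t ^+ 2 * enorm x ^+ 2 - 2 * t * (\sum_i x 0 i * y 0 i)
    + enorm y ^+ 2.
  rewrite !sqr_enorm !mulr_sumr -sumrB -big_split/= sumr_ge0// => i _.
  rewrite (_ : _ + _ = (t * x 0 i - y 0 i) ^+ 2) ?sqr_ge0//; ring.
have [x0|x0] := eqVneq (enorm x) 0.
  rewrite x0 mul0r big1// => i _.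
  have := coord_le_enorm x i; rewrite x0 normr_le0 => /eqP ->.
  by rewrite mul0r.
have xp : 0 < enorm x by rewrite lt_def x0 enorm_ge0.
set S := \sum_i _ in Cge0 *.
have [S0|S0] := lerP S 0; first by rewrite (le_trans S0)// mulr_ge0 ?enorm_ge0.
have := Cge0 (S / enorm x ^+ 2).
have -> : (S / enorm x ^+ 2) ^+ 2 * enorm x ^+ 2 - 2 * (S / enorm x ^+ 2) * S
  + enorm y ^+ 2 = enorm y ^+ 2 - S ^+ 2 / enorm x ^+ 2 by field.
rewrite subr_ge0 ler_pdivrMr ?exprn_gt0// => SS.
rewrite -(ler_pXn2r (ltn0Sn 1)) ?nnegrE ?(ltW S0) ?mulr_ge0 ?enorm_ge0//.
by rewrite exprMn mulrC.
Qed.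

Lemma enormD x y : enorm (x + y) <= enorm x + enorm y.
Proof.
rewrite -(ler_pXn2r (ltn0Sn 1)) ?nnegrE ?addr_ge0 ?enorm_ge0// sqrrD !sqr_enorm.
apply: (@le_trans _ _
    (\sum_i x 0 i ^+ 2 + (\sum_i x 0 i * y 0 i) *+ 2 + \sum_i y 0 i ^+ 2)).
  rewrite -sumrMnl -!big_split/= ler_sum// => i _.
  by rewrite mxE sqrrD.
by rewrite lerD2r lerD2l lerMn2r enorm_cauchy_schwarz orbT.
Qed.

Lemma enormN x : enorm (- x) = enorm x.
Proof. by congr Num.sqrt; apply: eq_bigr => i _; rewrite mxE sqrrN. Qed.

Lemma enorm_distrC x y : enorm (x - y) = enorm (y - x).
Proof. by rewrite -enormN opprB. Qed.

Lemma enorm_triangle (z x y : 'rV[R]_n.+1) :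
  enorm (x - y) <= enorm (x - z) + enorm (z - y).
Proof. by rewrite (le_trans _ (enormD _ _))// addrA subrK. Qed.

End enorm_theory.

(** * Lebesgue measure of boxes, balls and cubes *)

Section lebesgue_theory.
Context (R : realType) (n : nat).
Implicit Types (a b o : 'rV[R]_n.+1) (A B : set 'rV[R]_n.+1).
Local Notation mu := (@lebesgue R n).

Lemma box_volume_ge0 a b : (forall i, a 0 i <= b 0 i) -> 0 <= box_volume a b.
Proof. by move=> ab; apply: prodr_ge0 => i _; rewrite subr_ge0. Qed.

Lemma le_lebesgue A B : A `<=` B -> (mu A <= mu B)%E.
Proof. exact: (@le_outer_measure _ _ (@lebesgue_outer R n)). Qed.

Lemma lebesgueU_le A B : (mu (A `|` B) <= mu A + mu B)%E.
Proof. exact: (@outer_measureU2 _ _ (@lebesgue_outer R n)). Qed.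

Lemma lebesgue_ge0 A : (0 <= mu A)%E.
Proof. exact: (@outer_measure_ge0 _ _ (@lebesgue_outer R n)). Qed.

Lemma lebesgue_set0 : mu set0 = 0%E.
Proof. exact: (@outer_measure0 _ _ (@lebesgue_outer R n)). Qed.

Lemma lebesgue_le_cover A (a b : nat -> 'rV[R]_n.+1) : box_cover A a b ->
  (mu A <= \sum_(k <oo) (box_volume (a k) (b k))%:E)%E.
Proof. by move=> ab; apply: ereal_inf_lbound; exists a, b. Qed.

Lemma nneseries_single (u : nat -> \bar R) :
  (forall k, (0 < k)%N -> u k = 0%E) -> (0 <= u 0%N)%E ->
  (\sum_(k <oo) u k = u 0%N)%E.
Proof.
move=> u0 u00; rewrite nneseries_recl//; last first.
  by move=> [|k] _ //; rewrite u0.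
by rewrite eseries0 ?adde0// => k k0 _; exact: u0.
Qed.

Lemma lebesgue_box_le a b : (forall i, a 0 i <= b 0 i) ->
  (mu (box a b) <= (box_volume a b)%:E)%E.
Proof.
move=> ab.
apply: (le_trans (@lebesgue_le_cover _ (fun k => if k == 0%N then a else 0)
  (fun k => if k == 0%N then b else 0) _)).
  by split=> [[|k] i//=|x abx]; exists 0%N.
rewrite nneseries_single//=; last by rewrite lee_fin box_volume_ge0.
by case=> // k _; rewrite /box_volume/= big_ord_recl subrr mul0r.
Qed.

Definition set_coord a (i : 'I_n.+1) (m : R) : 'rV[R]_n.+1 :=
  \row_j (if j == i then m else a 0 j).

(** Cutting each box of a cover by the hyperplane [x 0 i = c] produces covers of
    the two pieces with the same total volume; half-spaces are therefore
    measurable, and they generate all the measurable sets used below. *)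
Lemma measurable_halfspace i (c : R) :
  measurable [set x : 'rV[R]_n.+1 | x 0 i <= c].
Proof.
apply: (@le_caratheodory_measurable _ _ (@lebesgue_outer R n)) => X.
apply: le_ereal_inf_tmp => _ [a [b [[ab Xab] ->]]].
(* The clamped value keeps the two boxes well formed when the hyperplane
   misses the box; one of them is then empty. *)
pose m k := Num.max (a k 0 i) (Num.min (b k 0 i) c).
have am k : a k 0 i <= m k by rewrite le_max lexx.
have mb k : m k <= b k 0 i by rewrite ge_max ab ge_min lexx.
have c1 : box_cover (X `&` [set x | x 0 i <= c]) a
    (fun k => set_coord (b k) i (m k)).
  split=> [k j|x [Xx /= xc]].
    by rewrite mxE; case: eqP => [->|_].
  have [k _ xk] := Xab _ Xx; exists k => // j; rewrite mxE.
  move: (xk j); rewrite !in_itv/= => /andP[-> xj] /=.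
  have [ji|//] := eqVneq j i.
  by subst j; rewrite /m le_max le_min xj xc orbT.
have c2 : box_cover (X `&` ~` [set x | x 0 i <= c])
    (fun k => set_coord (a k) i (m k)) b.
  split=> [k j|x [Xx /= /negP]]; rewrite -?ltNge.
    by rewrite mxE; case: eqP => [->|_].
  move=> xc; have [k _ xk] := Xab _ Xx; exists k => // j; rewrite mxE.
  move: (xk j); rewrite !in_itv/= => /andP[xj ->]; rewrite andbT.
  have [ji|//] := eqVneq j i.
  by subst j; rewrite /m gt_max xj gt_min xc orbT.
apply: (@le_trans _ _ (\sum_(k <oo) (box_volume (a k) (set_coord (b k) i (m k)))%:E +
   \sum_(k <oo) (box_volume (set_coord (a k) i (m k)) (b k))%:E))%E.
  by apply: leeD; apply: lebesgue_le_cover.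
rewrite -nneseriesD; last 2 first.
- by move=> k _ _; rewrite lee_fin box_volume_ge0//; exact: c1.1.
- by move=> k _ _; rewrite lee_fin box_volume_ge0//; exact: c2.1.
apply: lee_nneseries => [k _ _|k _].
  by rewrite -EFinD lee_fin addr_ge0// box_volume_ge0//; [exact: c1.1|exact: c2.1].
rewrite -EFinD lee_fin /box_volume.
rewrite (bigD1 i)//= [X in _ + X](bigD1 i)//= [X in _ <= X](bigD1 i)//=.
rewrite !mxE eqxx.
rewrite (eq_bigr (fun j => b k 0 j - a k 0 j)); last first.
  by move=> j /negbTE ji; rewrite mxE ji.
rewrite [X in _ + _ * X](eq_bigr (fun j => b k 0 j - a k 0 j)); last first.
  by move=> j /negbTE ji; rewrite mxE ji.
by rewrite -mulrDl addrC addrA subrK.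
Qed.

Lemma measurable_coord i :
  measurable_fun [set: 'rV[R]_n.+1] (fun x => x 0 i).
Proof.
apply: (measurability _ (RGenOInfty.measurableE R)) => _ [_ [c ->] <-].
rewrite setTI [X in measurable X](_ : _ = ~` [set x : 'rV[R]_n.+1 | x 0 i <= c]).
  exact/measurableC/measurable_halfspace.
by apply/seteqP; split => x /=; rewrite in_itv/= andbT ltNge => /negP.
Qed.

Lemma measurable_box a b : measurable (box a b).
Proof.
rewrite (_ : box a b =
    \bigcap_(i in [set: 'I_n.+1])
      ((fun x : 'rV[R]_n.+1 => x 0 i) @^-1` `]a 0 i, b 0 i])).
  apply: fin_bigcap_measurable => // i _.
  by rewrite -[X in measurable X]setTI; exact: measurable_coord.
by apply/seteqP; split=> x abx i => [_|]; exact: abx.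
Qed.

Lemma measurable_enormB o : measurable_fun [set: 'rV[R]_n.+1] (fun y => enorm (y - o)).
Proof.
have sm : measurable_fun setT (@Num.sqrt R).
  by apply: continuous_measurable_fun; exact: sqrt_continuous.
apply: (measurableT_comp sm).
apply: measurable_sum => i; apply: measurable_funX.
under eq_fun do rewrite !mxE.
by apply: measurable_funB => //; exact: measurable_coord.
Qed.

Lemma measurable_eball o (r : R) : measurable (eball o r).
Proof.
rewrite (_ : eball o r = (fun y => enorm (y - o)) @^-1` `]-oo, r[).
  by rewrite -[X in measurable X]setTI; exact: measurable_enormB.
by apply/seteqP; split => x /=; rewrite in_itv.
Qed.

(** Dilations and translations carry covers by boxes to covers by boxes and
    multiply all the volumes by the same factor. *)
Lemma lebesgue_scale (t : R) o A B : 0 < t ->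
  (forall x, A x -> B (o + t *: x)) ->
  ((t ^+ n.+1)%:E * mu A <= mu B)%E.
Proof.
move=> t0 AB; apply: le_ereal_inf_tmp => _ [a [b [[ab Bab] ->]]].
have t10 : 0 < t^-1 by rewrite invr_gt0.
pose S (c : nat -> 'rV[R]_n.+1) k : 'rV[R]_n.+1 := t^-1 *: (c k - o).
have cS : box_cover A (S a) (S b).
  split=> [k i|x /AB/Bab[k _ xk]].
    by rewrite !mxE ler_pM2l// lerD2r.
  exists k => // i; move: (xk i); rewrite !in_itv/= !mxE.
  rewrite ltr_pdivrMl// ler_pdivlMl// ltrBlDl lerBrDl.
  by [].
have volS k : box_volume (a k) (b k) = t ^+ n.+1 * box_volume (S a k) (S b k).
  rewrite /box_volume (eq_bigr (fun i => t * (S b k 0 i - S a k 0 i))).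
    by rewrite big_split/= prodr_const card_ord.
  by move=> i _; rewrite !mxE -mulrBr mulVKf ?gt_eqF//; ring.
under eq_eseriesr do rewrite volS EFinM.
rewrite nneseriesZl.
  apply: lee_wpmul2l; first by rewrite lee_fin exprn_ge0 ?ltW.
  exact: lebesgue_le_cover.
by move=> k _; rewrite lee_fin box_volume_ge0//; exact: cS.1.
Qed.

Definition cube o (s : R) : set 'rV[R]_n.+1 := box o (o + const_mx s).

(** Scaling determines the measure of all cubes up to this factor, which cancels
    in the ratios of measures that the proof compares. *)
Definition unit_cube_measure : R := fine (mu (cube 0 1)).

Lemma lebesgue_unit_cube : mu (cube 0 1) = unit_cube_measure%:E.
Proof.
rewrite fineK// ge0_fin_numE; last exact: lebesgue_ge0.
apply: le_lt_trans (ltry (box_volume 0 (0 + const_mx 1))).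
by apply: lebesgue_box_le => i; rewrite !mxE add0r.
Qed.

Lemma unit_cube_measure_ge0 : 0 <= unit_cube_measure.
Proof. by rewrite -lee_fin -lebesgue_unit_cube lebesgue_ge0. Qed.

Lemma lebesgue_cube o (s : R) : 0 < s ->
  mu (cube o s) = (s ^+ n.+1 * unit_cube_measure)%:E.
Proof.
move=> s0; apply/eqP; rewrite eq_le EFinM -lebesgue_unit_cube.
apply/andP; split; last first.
  apply: (@lebesgue_scale s o) => // x x01 i; move: (x01 i).
  rewrite !in_itv/= !mxE add0r => /andP[x0 x1].
  by rewrite ltrDl mulr_gt0//= lerD2l ler_piMr// ltW.
have s10 : 0 < s^-1 by rewrite invr_gt0.
have : ((s^-1 ^+ n.+1)%:E * mu (cube o s) <= mu (cube 0 1))%E.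
  apply: (@lebesgue_scale s^-1 (- (s^-1 *: o))) => // x xos i; move: (xos i).
  rewrite !in_itv/= !mxE add0r => /andP[x0 x1].
  rewrite (_ : - _ + _ = s^-1 * (x 0 i - o 0 i)); last by ring.
  by rewrite mulr_gt0 ?subr_gt0//= ler_pdivrMl// mulr1 lerBlDl.
by rewrite exprVn lee_pdivrMl ?exprn_gt0.
Qed.

Lemma eball_sub_cube o (r : R) : eball o r `<=` cube (o - const_mx r) (2 * r).
Proof.
move=> y yr i; have := le_lt_trans (coord_le_enorm _ i) yr.
rewrite !in_itv/= !mxE ltr_norml => /andP[H1 H2].
by apply/andP; split; lra.
Qed.

Lemma cube_sub_eball o (s : R) : 0 < s -> cube o s `<=` eball o (n.+2%:R * s).
Proof.
move=> s0 y ys; rewrite /eball/= (@le_lt_trans _ _ (n.+1%:R * s))//.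
  apply: enorm_le_coord => [|i]; first exact: ltW.
  move: (ys i); rewrite in_itv/= !mxE => /andP[H1 H2].
  by rewrite ger0_norm; lra.
by rewrite ltr_pM2r// ltr_nat.
Qed.

End lebesgue_theory.

(** * Series and integrals of nonnegative real functions *)

Section series.
Context (R : realType).

Lemma nneseries_geometric (a z : R) : 0 <= z < 1 ->
  (\sum_(k <oo) (a * z ^+ k)%:E = (a / (1 - z))%:E)%E.
Proof.
move=> /andP[z0 z1].
have cv := @cvg_geometric_series R a z; rewrite ger0_norm// in cv.
have {cv} cv := cv z1.
apply: cvg_lim => //.
rewrite (_ : (fun m => _) = EFin \o series (geometric a z)).
  by apply: cvg_EFin => //; exact: nearW.
by apply/funext => m /=; rewrite sumEFin.
Qed.

Lemma nneseries_ge_term (v : nat -> \bar R) j : (forall k, (0 <= v k)%E) ->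
  (v j <= \sum_(k <oo) v k)%E.
Proof.
by move=> v0; rewrite (@nneseriesD1 _ v j xpredT)// leeDl// nneseries_ge0.
Qed.

(** Absorbs the polynomial factors of the far estimate in a slightly larger
    ratio, so that only geometric series remain to be summed. *)
Lemma natS_exp_le (r q : R) (k : nat) : 0 <= r -> r < q -> q < 1 ->
  k.+1%:R * r ^+ k <= q / (q - r) * q ^+ k.
Proof.
move=> r0 rq q1; have q0 : 0 < q := le_lt_trans r0 rq.
have qr : 0 < q - r by rewrite subr_gt0.
rewrite mulrAC ler_pdivlMr//.
elim: k => [|k IH]; first by rewrite !expr0; lra.
have q2 : 0 <= q ^+ k by rewrite exprn_ge0// ltW.
have r2 : 0 <= r ^+ k by rewrite exprn_ge0.
have rk : r ^+ k.+1 <= q ^+ k.+1 by rewrite lerXn2r ?nnegrE// ltW.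
rewrite -natr1 mulrDl mul1r mulrDl.
have : k.+1%:R * r ^+ k.+1 * (q - r) <= r * (q * q ^+ k).
  by rewrite exprS mulrCA -mulrA ler_wpM2l.
have : r ^+ k.+1 * (q - r) <= q ^+ k.+1 * (q - r) by rewrite ler_wpM2r// ltW.
rewrite !exprS; lra.
Qed.

End series.

Section integral_real.
Context (R : realType) (n : nat).
Local Notation mu := (@lebesgue R n).
Implicit Types (D A : set 'rV[R]_n.+1) (f g : 'rV[R]_n.+1 -> R).
Local Notation mfun f := (measurable_fun [set: 'rV[R]_n.+1] f).

Lemma measurable_EFin_comp D f : mfun f -> measurable_fun D (fun x => (f x)%:E).
Proof.
move=> mf; apply: measurable_funTS.
exact: (measurableT_comp (@EFin_measurable R setT) mf).
Qed.

Lemma lebesgue_le_integral D f g : measurable D -> mfun f -> mfun g ->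
  (forall x, 0 <= f x) -> (forall x, D x -> f x <= g x) ->
  (\int[mu]_(x in D) (f x)%:E <= \int[mu]_(x in D) (g x)%:E)%E.
Proof.
move=> mD mf mg f0 fg; apply: ge0_le_integral.
- exact: mD.
- by move=> x _; rewrite lee_fin.
- exact: measurable_EFin_comp.
- exact: measurable_EFin_comp.
- by move=> x Dx; rewrite lee_fin fg.
Qed.

Lemma lebesgue_integralD D f g : measurable D -> mfun f -> mfun g ->
  (forall x, 0 <= f x) -> (forall x, 0 <= g x) ->
  (\int[mu]_(x in D) (f x + g x)%:E =
   \int[mu]_(x in D) (f x)%:E + \int[mu]_(x in D) (g x)%:E)%E.
Proof.
move=> mD mf mg f0 g0; rewrite -ge0_integralD.
- by [].
- exact: mD.
- by move=> x _; rewrite lee_fin.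
- exact: measurable_EFin_comp.
- by move=> x _; rewrite lee_fin.
- exact: measurable_EFin_comp.
Qed.

Lemma lebesgue_integralZl D f (k : R) : measurable D -> mfun f ->
  (forall x, 0 <= f x) -> 0 <= k ->
  (\int[mu]_(x in D) (k * f x)%:E = k%:E * \int[mu]_(x in D) (f x)%:E)%E.
Proof.
move=> mD mf f0 k0; rewrite -ge0_integralZl.
- by [].
- exact: mD.
- exact: measurable_EFin_comp.
- by move=> x _; rewrite lee_fin.
- by rewrite lee_fin.
Qed.

Lemma lebesgue_subset_integral D A f : measurable D -> measurable A -> mfun f ->
  (forall x, 0 <= f x) -> D `<=` A ->
  (\int[mu]_(x in D) (f x)%:E <= \int[mu]_(x in A) (f x)%:E)%E.
Proof.
move=> mD mA mf f0 DA; apply: ge0_subset_integral.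
- exact: mD.
- exact: mA.
- exact: measurable_EFin_comp.
- by move=> x _; rewrite lee_fin.
- exact: DA.
Qed.

Lemma lebesgue_integral_indic D A : measurable D -> measurable A ->
  (\int[mu]_(x in D) (\1_A x : R)%:E = mu (D `&` A))%E.
Proof. by move=> mD mA; rewrite setIC integral_indic. Qed.

Lemma measurable_indicRn A : measurable A -> mfun (\1_A : _ -> R).
Proof. by move=> mA; exact: measurable_indic. Qed.

Lemma lebesgue_integral_indicM A f : measurable A ->
  (\int[mu]_x (f x * \1_A x)%:E = \int[mu]_(x in A) (f x)%:E)%E.
Proof.
move=> mA; rewrite [RHS]integral_mkcond; apply: eq_integral => x _.
by rewrite /patch indicE; case: ifPn => _; rewrite ?mulr1 ?mulr0.
Qed.

Lemma measurable_distr f (a : R) : mfun f -> mfun (fun x => `|f x - a|).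
Proof.
move=> mf; have mB : mfun (fun x => f x - a) by exact: measurable_funB.
exact: (measurableT_comp (@normr_measurable R setT) mB).
Qed.

Lemma measurable_ge f (l : R) : mfun f -> measurable [set x | l <= f x].
Proof.
move=> mf; rewrite (_ : [set x | _] = f @^-1` `[l, +oo[).
  by rewrite -[X in measurable X]setTI; exact: mf.
by apply/seteqP; split => x /=; rewrite in_itv/= andbT.
Qed.

Lemma measurable_gt f (l : R) : mfun f -> measurable [set x | l < f x].
Proof.
move=> mf; rewrite (_ : [set x | _] = f @^-1` `]l, +oo[).
  by rewrite -[X in measurable X]setTI; exact: mf.
by apply/seteqP; split => x /=; rewrite in_itv/= andbT.
Qed.

(** Integrate [l * \1_A <= f] over [D]. *)
Lemma lebesgue_markov D A f (l : R) :
  measurable D -> measurable A -> 0 <= l -> mfun f ->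
  (forall x, 0 <= f x) -> (forall x, A x -> l <= f x) ->
  (l%:E * mu (D `&` A) <= \int[mu]_(x in D) (f x)%:E)%E.
Proof.
move=> mD mA l0 mf f0 lf; have mI := measurable_indicRn mA.
rewrite -lebesgue_integral_indic// -lebesgue_integralZl//.
apply: lebesgue_le_integral.
- exact: mD.
- by apply: measurable_funM => //; exact: mI.
- exact: mf.
- by move=> x; rewrite mulr_ge0.
move=> x _; rewrite indicE; case: (boolP (x \in A)) => xA.
  by rewrite mulr1 lf//; rewrite inE in xA.
by rewrite mulr0.
Qed.

End integral_real.

(** * Dyadic cells and a weak density theorem *)

Section fibers.
Context (R : realType) (n : nat).
Local Notation mu := (@lebesgue R n).
Implicit Types A E U : set 'rV[R]_n.+1.

(** A comparison of measures on the pieces of a countable partition of [U]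
    adds up.  The partition is given as the fibers of a function, which makes
    the pieces disjoint by construction; [A] may be any set, its outer measure
    being subadditive. *)
Lemma lebesgue_le_fibers (key : 'rV[R]_n.+1 -> nat) A E U (c : R) : 0 <= c ->
  measurable E -> (forall m, measurable (U `&` key @^-1` [set m])) ->
  (forall m, (mu (A `&` (U `&` key @^-1` [set m])) <=
     c%:E * mu (E `&` (U `&` key @^-1` [set m])))%E) ->
  (mu (A `&` U) <= c%:E * mu (E `&` U))%E.
Proof.
move=> c0 mE mU AE; set S := fun m => U `&` key @^-1` [set m] in mU AE.
have UE B : B `&` U = \bigcup_m (B `&` S m).
  apply/seteqP; split=> [x [Bx Ux]|x [m _ [Bx [Ux _]]]] //.
  by exists (key x).
rewrite !UE.
apply: (le_trans (@outer_measure_sigma_subadditive _ _ (@lebesgue_outer R n) _)).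
apply: (@le_trans _ _ (\sum_(m <oo) c%:E * mu (E `&` S m))%E).
  by apply: lee_nneseries => [m _ _|m _]; [exact: lebesgue_ge0|exact: AE].
rewrite nneseriesZl; last by move=> i _; exact: lebesgue_ge0.
apply: lee_wpmul2l; first by rewrite lee_fin.
rewrite (@measure_semi_bigcup _ _ _ (@lebesgue R n))//.
- by move=> m; apply: measurableI => //; exact: mU.
- apply/trivIsetP => i j _ _ ij; apply/seteqP; split => // x.
  by move=> [[_ [_ /= xi]] [_ [_ /= xj]]]; rewrite -xi -xj eqxx in ij.
- by apply: bigcup_measurable => m _; apply: measurableI => //; exact: mU.
Qed.

End fibers.

Section dyadic.
Context (R : realType) (n : nat) (o : 'rV[R]_n.+1) (s : R).
Hypothesis s0 : 0 < s.
Local Notation mu := (@lebesgue R n).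
Implicit Types (x y : 'rV[R]_n.+1) (v : {ffun 'I_n.+1 -> int}).

(** Dyadic cells are the fibers of [level k]: two points are in the same cell
    of generation [k] when they have the same [level k].  Ceilings match boxes
    that are open below and closed above. *)
Definition level k x : {ffun 'I_n.+1 -> int} :=
  [ffun i => Num.ceil (2 ^+ k * ((x 0 i - o 0 i) / s))].

Definition cell_corner k v : 'rV[R]_n.+1 :=
  \row_i (o 0 i + s / 2 ^+ k * (v i - 1)%:~R).

Definition cell k v : set 'rV[R]_n.+1 := cube (cell_corner k v) (s / 2 ^+ k).

Lemma cell_side_gt0 k : 0 < s / 2 ^+ k.
Proof. by rewrite divr_gt0// exprn_gt0. Qed.

Lemma cellP k v x : cell k v x <-> level k x = v.
Proof.
have e i (m : int) : (o 0 i + s / 2 ^+ k * m%:~R < x 0 i) =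
    (m%:~R < 2 ^+ k * ((x 0 i - o 0 i) / s)).
  rewrite (_ : 2 ^+ k * _ = (x 0 i - o 0 i) / (s / 2 ^+ k)).
    by rewrite ltr_pdivlMr ?cell_side_gt0// -ltrBrDl mulrC.
  by field; rewrite expf_neq0//= gt_eqF.
have e1 i (m : int) : (x 0 i <= o 0 i + s / 2 ^+ k * (m - 1)%:~R + s / 2 ^+ k) =
    (2 ^+ k * ((x 0 i - o 0 i) / s) <= m%:~R).
  rewrite leNgt [RHS]leNgt -e; congr (~~ (_ < _)); rewrite intrB; ring.
split=> [xv|<- i].
  apply/ffunP => i; rewrite ffunE; apply: ceil_def.
  by move: (xv i); rewrite in_itv/= !mxE e e1.
by rewrite in_itv/= !mxE e e1 ffunE ceil_itv.
Qed.

Lemma cell_levelE k x y : cell k (level k x) y <-> level k y = level k x.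
Proof. exact: cellP. Qed.

Lemma cell_refl k x : cell k (level k x) x.
Proof. exact/cell_levelE. Qed.

(** Cells are nested: if [ceil t < ceil u] then [2 * ceil t] separates [2 * t]
    from [2 * u]. *)
Lemma level_pred k x y : level k.+1 x = level k.+1 y -> level k x = level k y.
Proof.
move=> /ffunP xy; apply/ffunP => i; move: (xy i); rewrite !ffunE exprS -!mulrA.
move: (2 ^+ k * _) (2 ^+ k * _) => t u.
wlog tu : t u / Num.ceil t < Num.ceil u.
  move=> H tu; have [/H|/H|//] := ltgtP (Num.ceil t) (Num.ceil u).
    by move/(_ tu).
  by move/(_ (esym tu)).
move=> tu2; have : Num.ceil (2 * t) < Num.ceil (2 * u).
  apply: (@le_lt_trans _ _ (2 * Num.ceil t)).
    by rewrite ceil_le_int intrM ler_pM2l// ceil_ge.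
  by rewrite ceil_gt_int intrM ltr_pM2l// -ceil_gt_int.
by rewrite tu2 ltxx.
Qed.

Lemma level_le j k x y : (j <= k)%N -> level k x = level k y ->
  level j x = level j y.
Proof.
move=> jk; rewrite -(subnK jk); elim: (k - j)%N => // m IH.
by rewrite addSn => /level_pred.
Qed.

Lemma measurable_cell k v : measurable (cell k v).
Proof. exact: measurable_box. Qed.

Lemma lebesgue_cell k v :
  mu (cell k v) = ((s / 2 ^+ k) ^+ n.+1 * unit_cube_measure R n)%:E.
Proof. by rewrite lebesgue_cube// cell_side_gt0. Qed.

Lemma lebesgue_cellS k v v' :
  mu (cell k v) = ((2 ^+ n.+1)%:E * mu (cell k.+1 v'))%E.
Proof.
rewrite !lebesgue_cell -EFinM mulrA -exprMn; congr (_ ^+ _ * _)%:E.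
by rewrite exprS; field; rewrite expf_neq0.
Qed.

Lemma cell0E : cube o s = cell 0 [ffun => 1].
Proof.
rewrite /cell expr0 divr1; congr cube; apply/rowP => i.
by rewrite mxE ffunE subrr mulr0 addr0.
Qed.

(** If [N] fills at most half of each cell, at all scales, then it fills at most
    half of each box, the cells meeting a box being contained in a slightly
    larger one; as the measure of [N] is the infimum of the total volumes of
    its covers by boxes, it is at most half of itself. *)
Lemma half_density_null (N : set 'rV[R]_n.+1) : (mu N < +oo)%E ->
  (forall k x, N x ->
     (mu (N `&` cell k (level k x)) <= 2^-1%:E * mu (cell k (level k x)))%E) ->
  mu N = 0%E.
Proof.
move=> Noo Nhalf.
have Ncell k v : (mu (N `&` cell k v) <= 2^-1%:E * mu (cell k v))%E.
  have [[x [Nx /cellP <-]]|N0] := pselect (N `&` cell k v !=set0).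
    exact: Nhalf.
  rewrite (_ : N `&` cell k v = set0); last first.
    by apply/seteqP; split => // x xv; apply: N0; exists x.
  by rewrite lebesgue_set0 mule_ge0// lebesgue_ge0.
(* The union [U] of the cells of generation [k] meeting a box is covered by
   the box enlarged by the side of a cell on each face. *)
have Nbig k (a b : 'rV[R]_n.+1) : (forall i, a 0 i <= b 0 i) ->
    (mu (N `&` box a b) <= 2^-1%:E * (box_volume (a - const_mx (s / 2 ^+ k))
      (b + const_mx (s / 2 ^+ k)))%:E)%E.
  move=> ab; pose U := [set y | exists2 x, box a b x & level k x = level k y].
  have UU m : U `&` (pickle \o level k) @^-1` [set m] =
      \bigcup_(v in [set v | pickle v = m /\ exists2 x, box a b x & level k x = v])
        cell k v.
    apply/seteqP; split => [y [[x abx xy] /= ym]|y [v [vm [x abx xv] /cellP yv]]].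
      by exists (level k y); [split=> //; exists x|exact/cellP].
    by split => /=; [exists x => //; rewrite xv|rewrite yv].
  have fib m : U `&` (pickle \o level k) @^-1` [set m] = set0 \/
      exists v, U `&` (pickle \o level k) @^-1` [set m] = cell k v.
    rewrite UU; have [[v [vm xv]]|] := pselect (exists v, pickle v = m /\
      exists2 x, box a b x & level k x = v).
      right; exists v; apply/seteqP; split => [y [w [wm _]]|y yv].
        by rewrite -vm in wm; move/(pcan_inj pickleK): wm => ->.
      by exists v.
    by move=> H; left; apply/seteqP; split => // y [v vm _]; apply: H; exists v.
  have := @lebesgue_le_fibers R n (pickle \o level k) N setT U 2^-1.
  rewrite setTI => /(_ _ _ _ _) H.
  apply: (@le_trans _ _ (mu (N `&` U))).
    by apply: le_lebesgue; apply: setIS => x abx; exists x.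
  apply: (le_trans (H _ _ _ _)) => //.
  - by move=> m; have [->|[v ->]] := fib m => //; exact: measurable_cell.
  - move=> m; rewrite setTI; have [->|[v ->]] := fib m; last exact: Ncell.
    by rewrite setI0 lebesgue_set0 mule_ge0.
  apply: lee_wpmul2l; first by rewrite lee_fin.
  apply: (@le_trans _ _ (mu (box (a - const_mx (s / 2 ^+ k)) (b + const_mx (s / 2 ^+ k))))).
    apply: le_lebesgue => y [x abx /esym/cell_levelE yx] i.
    move: (abx i) (yx i) (cell_refl k x i); rewrite !in_itv/= !mxE.
    move=> /andP[H1 H2] /andP[H3 H4] /andP[H5 H6].
    apply/andP; split; lra.
  apply: lebesgue_box_le => i; rewrite !mxE.
  by have := ab i; have := cell_side_gt0 k; lra.
have Nbox (a b : 'rV[R]_n.+1) : (forall i, a 0 i <= b 0 i) ->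
    (mu (N `&` box a b) <= 2^-1%:E * (box_volume a b)%:E)%E.
  (* The volume of the enlarged box is a polynomial in the enlargement. *)
  move=> ab; pose p := \prod_i ((b 0 i - a 0 i)%:P + 2 *: 'X).
  have pE d : p.[d] = \prod_i (b 0 i - a 0 i + 2 * d).
    by rewrite horner_prod; apply: eq_bigr => i _; rewrite !hornerE.
  have vE d : box_volume (a - const_mx d) (b + const_mx d) = p.[d].
    by rewrite pE; apply: eq_bigr => i _; rewrite !mxE; ring.
  have v0 : box_volume a b = p.[0].
    by rewrite pE; apply: eq_bigr => i _; rewrite mulr0 addr0.
  have Nfin : mu (N `&` box a b) \is a fin_num.
    rewrite ge0_fin_numE ?lebesgue_ge0// (le_lt_trans _ Noo)//.
    by apply: le_lebesgue => x [].
  rewrite -(fineK Nfin) -EFinM lee_fin v0.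
  have pcv : 2^-1 * p.[s / 2 ^+ k] @[k --> \oo] --> 2^-1 * p.[0].
    apply: cvgMr; apply: continuous_cvg; first exact: continuous_horner.
    have := @cvg_geometric R s 2^-1; rewrite ger0_norm// => /(_ _).
    rewrite (_ : geometric s 2^-1 = (fun k => s / 2 ^+ k)).
      by apply; lra.
    by apply/funext => k; rewrite /= exprVn.
  rewrite -(cvg_lim _ pcv)//; apply: limr_ge; first by apply/cvg_ex; eexists; exact: pcv.
  near=> k; rewrite -vE -lee_fin EFinM (fineK Nfin); exact: Nbig.
suff : (2%:E * mu N <= mu N)%E.
  have N0 := lebesgue_ge0 N.
  have Nfin : mu N \is a fin_num by rewrite ge0_fin_numE.
  rewrite -(fineK Nfin) in N0 *; rewrite -EFinM lee_fin => H.
  move: N0; rewrite lee_fin => N0.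
  by congr EFin; lra.
apply: le_ereal_inf_tmp => _ [a [b [[ab Nab] ->]]].
rewrite -lee_pdivlMl// -nneseriesZl; last first.
  by move=> k _; rewrite lee_fin box_volume_ge0.
apply: (@le_trans _ _ (\sum_(k <oo) mu (N `&` box (a k) (b k)))%E).
  rewrite -[X in (mu X <= _)%E](setIidl Nab) setI_bigcupr.
  exact: (@outer_measure_sigma_subadditive _ _ (@lebesgue_outer R n)).
by apply: lee_nneseries => [k _ _|k _]; [exact: lebesgue_ge0|exact: Nbox].
Unshelve. all: by end_near. Qed.

End dyadic.

(** * Young's inequality for the function Phi *)

Section young.
Context (R : realType).
Implicit Types g s t : R.

Lemma logplus_ge0 t : 0 <= logplus t.
Proof. by rewrite /logplus le_max lexx orbT. Qed.

Lemma le_Phi t : 0 <= t -> t <= Phi t.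
Proof. by move=> t0; rewrite /Phi ler_peMr// lerDl logplus_ge0. Qed.

Lemma Phi_ge0 t : 0 <= t -> 0 <= Phi t.
Proof. by move=> t0; rewrite (le_trans t0)// le_Phi. Qed.

Lemma Phi0 : Phi (0 : R) = 0.
Proof. by rewrite /Phi mul0r. Qed.

Lemma ln_le_logplus t : ln t <= logplus t.
Proof. by rewrite /logplus le_max lexx. Qed.

Lemma measurable_Phi : measurable_fun [set: R] (@Phi R).
Proof.
apply: measurable_funM => //; apply: measurable_funD => //.
apply: measurable_maxr => //; exact: measurable_ln.
Qed.

Lemma Phi_double t : 0 <= t -> Phi (2 * t) <= 4 * Phi t.
Proof.
rewrite le_eqVlt => /orP[/eqP <-|t0]; first by rewrite mulr0 Phi0 mulr0.
have -> : 4 * Phi t = 2 * t * (2 * (1 + logplus t)) by rewrite /Phi; ring.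
rewrite /Phi; apply: ler_wpM2l; first by rewrite mulr_ge0// ltW.
have L0 := logplus_ge0 t; have L1 := ln_le_logplus t.
have H : logplus (2 * t) <= 1 + logplus t.
  rewrite {1}/logplus ge_max addr_ge0// andbT lnM ?posrE// lerD//.
  by have := @le_ln1Dx R 1; apply; lra.
lra.
Qed.

(** Either [s <= a], or [g >= exp (ga * s / 2)] and then [s <= 2 / ga * ln g],
    or [g] is so small that the product is absorbed by the exponential, with a
    gain coming from [s > a].  The gain makes the coefficient of the
    exponential as small as desired, at the price of the factor [a] in front
    of [Phi g]. *)
Lemma young_LlogL (ga a s g : R) : 0 < ga -> 0 <= a -> 0 <= s -> 0 <= g ->
  s * g <= (a + 2 / ga) * Phi g + 4 / ga * expR (- (ga * a / 4)) * expR (ga * s).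
Proof.
move=> ga0 a0 s0 g0; have Pg := le_Phi g0; have Pg0 := Phi_ge0 g0.
have e0 : 0 <= 4 / ga * expR (- (ga * a / 4)) * expR (ga * s).
  by rewrite !mulr_ge0 ?expR_ge0// invr_ge0 ltW.
have i0 : 0 < ga^-1 by rewrite invr_gt0.
have [sa|sa] := lerP s a.
  rewrite -[leLHS]addr0 lerD//.
  apply: (@le_trans _ _ (a * Phi g)); first by rewrite ler_pM.
  by rewrite ler_wpM2r// lerDl mulr_ge0// ltW.
have [gl|gl] := lerP (expR (ga * s / 2)) g.
  rewrite -[leLHS]addr0 lerD//.
  have gp : 0 < g := lt_le_trans (expR_gt0 _) gl.
  apply: (@le_trans _ _ (2 / ga * Phi g)); last first.
    by rewrite ler_wpM2r// lerDr.
  rewrite mulrC /Phi mulrCA ler_wpM2l//.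
  have : ga * s / 2 <= 1 + logplus g.
    rewrite (@le_trans _ _ (ln g))//; last first.
      by rewrite (le_trans (ln_le_logplus g))// lerDr.
    by rewrite -ler_expR lnK ?posrE.
  move=> H; rewrite mulrAC ler_pdivlMr//; lra.
rewrite -[leLHS]add0r lerD//; first by rewrite mulr_ge0// addr_ge0// mulr_ge0// ltW.
have s1 : s <= 4 / ga * expR (ga * s / 4).
  rewrite mulrAC ler_pdivlMr//.
  have := expR_ge1Dx (ga * s / 4); lra.
apply: (@le_trans _ _ (4 / ga * expR (ga * s / 4) * expR (ga * s / 2))).
  by rewrite ler_pM// ltW.
rewrite -!mulrA ler_wpM2l// ler_wpM2l ?(ltW i0)// -!expRD ler_expR.
have : ga * a <= ga * s by rewrite ler_pM2l// ltW.
lra.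
Qed.

Lemma measurable_comp_Phi n (g : 'rV[R]_n.+1 -> R) :
  measurable_fun [set: 'rV[R]_n.+1] g ->
  measurable_fun [set: 'rV[R]_n.+1] (fun x => Phi (g x)).
Proof. exact: (measurableT_comp measurable_Phi). Qed.

End young.

(** * The John-Nirenberg inequality *)

Section john_nirenberg.
Context (R : realType) (n : nat).
Local Notation mu := (@lebesgue R n).
Local Notation u := (unit_cube_measure R n).
Variables (b : 'rV[R]_n.+1 -> R) (c : 'rV[R]_n.+1 -> R -> R) (M : R).
Hypothesis mb : measurable_fun [set: 'rV[R]_n.+1] b.
Hypothesis M0 : 0 < M.

Definition osc_set (o : 'rV[R]_n.+1) (s l : R) : set 'rV[R]_n.+1 :=
  cube o s `&` [set x | l < `|b x - c o s|].

(** A weak-type control of the oscillation around arbitrary constants attached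
    to the cubes; in this form the decay of [osc_set] is a statement on
    measures of sets alone. *)
Hypothesis weak_osc : forall o (s l : R), 0 < s -> 0 < l ->
  (l%:E * mu (osc_set o s l) <= M%:E * mu (cube o s))%E.

Lemma measurable_osc_set o s l : measurable (osc_set o s l).
Proof.
apply: measurableI; first exact: measurable_box.
exact/measurable_gt/measurable_distr.
Qed.

Lemma osc_set_fin o (s l : R) : 0 < s -> mu (osc_set o s l) \is a fin_num.
Proof.
move=> s0; rewrite ge0_fin_numE ?lebesgue_ge0//.
apply: (@le_lt_trans _ _ (mu (cube o s))); first by apply: le_lebesgue => x [].
by rewrite lebesgue_cube// ltry.
Qed.

(** When the level grows by this amount, the measure of [osc_set] is halved:
    [3 * M] pays for the change of centre from the cube to a stopping cell, and
    [2 ^+ n.+3 * M] makes the exceptional set of the parent of a stopping cell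
    a fraction [2^-(n+3)] of it, that is a quarter of the cell. *)
Definition osc_step : R := (3 + 2 ^+ n.+3) * M.

(** The cells in which [E := osc_set o s l] first fills more than half of the
    cell cover almost all of [E], by [half_density_null].  In the parent [P] of
    such a cell [E] fills at most half, so some point of [P] outside [E] is
    close to [c] of [P]; this bounds the difference between the constants of
    [P] and of the cube by [l + 3 * M].  The points of the cell at the higher
    level then oscillate a lot around the constant of [P], hence they are few,
    compared with the cell and so with its intersection with [E]. *)
Lemma osc_set_decay o (s l : R) : 0 < s -> 2 * M <= l ->
  (mu (osc_set o s (l + osc_step)) <= 2^-1%:E * mu (osc_set o s l))%E.
Proof.
move=> s0 Ml; set E := osc_set o s l.
have l0 : 0 < l by rewrite (lt_le_trans _ Ml)// mulr_gt0.
have mE : measurable E by exact: measurable_osc_set.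
pose cel k x := cell o s k (level o s k x).
pose dense x := [pred k | (2^-1%:E * mu (cel k x) < mu (E `&` cel k x))%E].
pose O := [set x | cube o s x /\ exists k, dense x k].
have celP k x y : cel k x y -> level o s k y = level o s k x.
  by move=> xy; apply/(cellP o s0).
have celR k x y : level o s k y = level o s k x -> cel k x y.
  by move=> xy; apply/(cellP o s0).
have cel_le j k x y : (j <= k)%N -> cel k x y -> cel j x y.
  by move=> jk /celP xy; apply: celR; exact: (level_le jk xy).
have celE k x y : cel k x y -> forall j, (j <= k)%N -> cel j y = cel j x.
  by move=> yx j jk; rewrite /cel (celP _ _ _ (cel_le _ _ _ _ jk yx)).
have denseE k x y : cel k x y -> forall j, (j <= k)%N -> dense y j = dense x j.
  by move=> xy j jk; rewrite /= (celE _ _ _ xy _ jk).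
have cel0 x : cube o s x -> cel 0%N x = cube o s.
  rewrite (cell0E o s) => xQ; rewrite /cel; congr cell.
  by apply/(cellP _ s0).
(* [stop x] is the first generation at which [E] is dense in the cell of [x];
   the stopping cells are the fibers of [key]. *)
pose stop x := if pselect (exists k, dense x k) is left e then ex_minn e else 0%N.
pose key x : nat := pickle (stop x, level o s (stop x) x).
have stopE x k : dense x k -> (forall j, dense x j -> (k <= j)%N) -> stop x = k.
  move=> xk km; rewrite /stop; case: pselect => [e|]; last by case; exists k.
  case: ex_minnP => j xj jm; apply/eqP; rewrite eqn_leq jm//=; exact: km.
have stopP x : (exists k, dense x k) -> dense x (stop x).
  by move=> e; rewrite /stop; case: pselect => // e'; case: ex_minnP.
have stop_min x j : dense x j -> (stop x <= j)%N.
  move=> xj; rewrite /stop; case: pselect => [e|//]; case: ex_minnP => k _; exact.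
have pickleI (p q : nat * {ffun 'I_n.+1 -> int}) : pickle p = pickle q ->
    p.1 = q.1 /\ p.2 = q.2.
  by move/(pcan_inj pickleK) => ->.
have fibE x : O x -> O `&` key @^-1` [set key x] = cel (stop x) x.
  move=> [Qx ex]; apply/seteqP; split => [y [[Qy ey]]|y xy].
    move=> xy; have [/= yx H] := pickleI _ _ xy; rewrite yx in H.
    exact: celR.
  have Qy : cube o s y.
    by rewrite -(cel0 x Qx); exact: cel_le (leq0n (stop x)) xy.
  have yd : dense y (stop x) by rewrite (denseE _ _ _ xy)// stopP.
  have sy : stop y = stop x.
    apply: stopE => // j yj; rewrite leqNgt; apply/negP => jx.
    have := stop_min x j; rewrite -(denseE _ _ _ xy _ (ltnW jx)) => /(_ yj).
    by rewrite leqNgt jx.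
  split; first by split; [exact: Qy|exists (stop x); exact: yd].
  by rewrite /preimage/= /key sy; congr (pickle (_, _)); exact: celP.
have fib m : O `&` key @^-1` [set m] = set0 \/
    exists2 x, O x & O `&` key @^-1` [set m] = cel (stop x) x.
  have [[x [Ox /= <-]]|H] := pselect (O `&` key @^-1` [set m] !=set0).
    by right; exists x => //; exact: fibE.
  by left; apply/seteqP; split => // x Ox; apply: H; exists x.
have EO0 : mu (E `&` ~` O) = 0%E.
  apply: (@half_density_null R n o s s0).
    rewrite (@le_lt_trans _ _ (mu E))//; first by apply: le_lebesgue => x [].
    by have := osc_set_fin o l s0; rewrite ge0_fin_numE ?lebesgue_ge0.
  move=> k x [[Qx lx] Ox].
  apply: (@le_trans _ _ (mu (E `&` cel k x))).
    by apply: le_lebesgue => y [[]].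
  by rewrite leNgt; apply/negP => xk; apply: Ox; split => //; exists k.
(* [2 * M <= l] forbids stopping at the cube itself, so that every stopping
   cell has a parent. *)
have not0 x : cube o s x -> ~~ dense x 0%N.
  move=> Qx; rewrite -leNgt cel0// setIidl; last by move=> y [].
  rewrite lee_pdivlMl//.
  have := weak_osc o s0 l0; rewrite -/E.
  rewrite -(fineK (osc_set_fin o l s0)) lebesgue_cube// -!EFinM !lee_fin -/E.
  set e := fine _; set q := _ * u => lM.
  have e0 : 0 <= e by rewrite fine_ge0// lebesgue_ge0.
  rewrite -(ler_pM2l M0) (le_trans _ lM)// mulrA mulrC [M * 2]mulrC.
  by rewrite mulrC ler_wpM2r.
have step k x : cube o s x -> dense x k.+1 -> ~~ dense x k ->
    (mu (osc_set o s (l + osc_step) `&` cel k.+1 x) <=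
    2^-1%:E * mu (E `&` cel k.+1 x))%E.
  move=> Qx /= xk1; rewrite -leNgt => xk.
  have PQ : cel k x `<=` cube o s.
    by rewrite -(cel0 x Qx) => y; exact: cel_le.
  have P1 : cel k.+1 x `<=` cel k x.
    by move=> y; exact: cel_le.
  pose op := cell_corner o s k (level o s k x); pose sp := s / 2 ^+ k.
  have sp0 : 0 < sp by exact: cell_side_gt0.
  have PE : cel k x = cube op sp by [].
  pose p := fine (mu (cel k.+1 x)).
  have p1E : mu (cel k.+1 x) = p%:E by rewrite /p (lebesgue_cell _ s0).
  have pE : mu (cel k x) = (2 ^+ n.+1 * p)%:E.
    by rewrite EFinM -p1E; exact: (lebesgue_cellS _ s0).
  have p0 : 0 < p.
    have : (2^-1%:E * p%:E < p%:E)%E.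
      rewrite -p1E (lt_le_trans xk1)//; first by apply: le_lebesgue => y [].
    rewrite -EFinM lte_fin; lra.
  have t0 : (0 : R) < 2 ^+ n.+1 by rewrite exprn_gt0.
  (* [E] fills at most a half, and the points far from the constant of the
     parent at most a third. *)
  have [y [Py Ey yc]] : exists y, [/\ cel k x y, ~ E y & `|b y - c op sp| <= 3 * M].
    apply: contrapT => H.
    have : (mu (cel k x) <= mu (E `&` cel k x) + mu (osc_set op sp (3 * M)))%E.
      apply: le_trans (lebesgueU_le _ _); apply: le_lebesgue => y Py.
      have [Ey|Ey] := pselect (E y); [by left|right; split => //=].
      by rewrite ltNge; apply/negP => yc; apply: H; exists y.
    have := weak_osc op sp0 (mulr_gt0 (ltr0n R 3) M0).
    rewrite -PE; rewrite pE in xk *.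
    rewrite -(fineK (osc_set_fin op (3 * M) sp0)).
    set w := fine _ => wp.
    move=> /le_trans => /(_ _ (leeD2r _ xk)).
    rewrite -!EFinM -EFinD !lee_fin in wp *.
    have : 3 * w <= 2 ^+ n.+1 * p by rewrite -(ler_pM2l M0); lra.
    have : 0 < 2 ^+ n.+1 * p by rewrite mulr_gt0.
    lra.
  have Qy := PQ _ Py.
  have yl : `|b y - c o s| <= l.
    by rewrite leNgt; apply/negP => ly; apply: Ey.
  have incl : osc_set o s (l + osc_step) `&` cel k.+1 x `<=`
      osc_set op sp (2 ^+ n.+3 * M).
    move=> z [[_ /= zl] zx]; split; first exact: P1.
    move=> /=; move: zl yl yc; rewrite /osc_step.
    have := ler_normD (b z - c op sp) (c op sp - c o s).
    have := ler_normD (c op sp - b y) (b y - c o s).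
    rewrite (distrC (c op sp) (b y)) !addrA !subrK.
    rewrite mulrDl; lra.
  have := weak_osc op sp0 (mulr_gt0 (exprn_gt0 n.+3 (ltr0n R 2)) M0).
  rewrite -PE pE => wp.
  apply: (@le_trans _ _ (mu (osc_set op sp (2 ^+ n.+3 * M)))).
    exact: le_lebesgue.
  apply: (@le_trans _ _ (2^-1%:E * (2^-1%:E * p%:E))%E); last first.
    by apply: lee_wpmul2l; rewrite ?lee_fin// -p1E ltW.
  rewrite -(fineK (osc_set_fin op (2 ^+ n.+3 * M) sp0)) in wp *.
  move: wp; set w := fine _; rewrite -!EFinM !lee_fin => wp.
  have : 4 * w <= p.
    rewrite -(ler_pM2l t0) -(ler_pM2l M0); move: wp.
    by rewrite 2!exprS; lra.
  lra.
have key_step x : O x -> (mu (osc_set o s (l + osc_step) `&` cel (stop x) x) <=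
    2^-1%:E * mu (E `&` cel (stop x) x))%E.
  move=> [Qx ex]; have := stopP _ ex; have := stop_min x.
  case: (stop x) => [|k] km xk; first by have := not0 _ Qx; rewrite xk.
  by apply: step => //; apply/negP => /km; rewrite ltnn.
have O_step : (mu (osc_set o s (l + osc_step) `&` O) <= 2^-1%:E * mu (E `&` O))%E.
  apply: (@lebesgue_le_fibers _ _ key) => // m.
    by have [->|[x _ ->]] := fib m => //; exact: measurable_cell.
  have [->|[x Ox ->]] := fib m; last exact: key_step.
  by rewrite setI0 lebesgue_set0 mule_ge0// lebesgue_ge0.
have K0 : 0 <= osc_step by rewrite mulr_ge0 ?ltW// addr_ge0// exprn_ge0.
apply: (@le_trans _ _ (mu (osc_set o s (l + osc_step) `&` O) + mu (E `&` ~` O))%E).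
  apply: le_trans (lebesgueU_le _ _); apply: le_lebesgue => x Ex.
  have [Ox|Ox] := pselect (O x); [by left|right; split => //].
  case: Ex => Qx /= xl; split => //=; apply: le_lt_trans xl; lra.
rewrite EO0 adde0 (le_trans O_step)//.
by apply: lee_wpmul2l; rewrite ?lee_fin//; apply: le_lebesgue => x [].
Qed.

Lemma osc_set_geometric o (s : R) (j : nat) : 0 < s ->
  (mu (osc_set o s (2 * M + osc_step *+ j)) <= (2^-1 ^+ j)%:E * mu (cube o s))%E.
Proof.
move=> s0; elim: j => [|j IH].
  by rewrite expr0 mul1e; apply: le_lebesgue => x [].
have K0 : 0 <= osc_step by rewrite mulr_ge0 ?ltW// addr_ge0// exprn_ge0.
rewrite [osc_step *+ _]mulrSr addrA; apply: (le_trans (osc_set_decay _ s0 _)).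
  by rewrite lerDl mulrn_wge0.
by rewrite exprS EFinM -muleA; apply: lee_wpmul2l; rewrite ?lee_fin.
Qed.

Lemma osc_step_gt0 : 0 < osc_step.
Proof. by rewrite mulr_gt0// addr_gt0// exprn_gt0. Qed.

(** Shifting the index by 2 absorbs the starting level [2 * M] of the
    iteration, less than [osc_step], and the passage to a non-strict
    inequality; hence the factor 4. *)
Lemma osc_set_exp_decay o (s : R) (j : nat) : 0 < s ->
  (mu (cube o s `&` [set x | (osc_step *+ j <= `|b x - c o s|)%R]) <=
    (4 * 2^-1 ^+ j)%:E * mu (cube o s))%E.
Proof.
move=> s0; have K0 := osc_step_gt0.
have [j2|j2] := ltnP j 2.
  apply: (@le_trans _ _ (mu (cube o s))); first by apply: le_lebesgue => x [].
  rewrite -[X in (X <= _)%E]mul1e; apply: lee_wpmul2r; first exact: lebesgue_ge0.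
  by rewrite lee_fin; case: j j2 => [|[|]]// _; rewrite ?expr0 ?expr1; lra.
rewrite -(subnK j2) addn2; set i := (j - 2)%N.
rewrite (_ : 4 * _ = 2^-1 ^+ i); last by rewrite 2!exprS; field.
apply: le_trans (osc_set_geometric o i s0); apply: le_lebesgue => x [Qx /= xj].
split => //=; apply: lt_le_trans xj.
rewrite [osc_step *+ i.+2]mulrSr [osc_step *+ i.+1]mulrSr -addrA.
rewrite [ltRHS]addrC ltrD2r.
have : 2 * M < osc_step.
  by rewrite ltr_pM2r//; have := exprn_gt0 n.+3 (ltr0n R 2); lra.
lra.
Qed.

(** Raising the level by [osc_step] multiplies the exponential by [4 / 3] and
    the measure by [1 / 2], so that the layers form a geometric series of ratio
    [2 / 3]. *)
Definition jn_exponent : R := ln (4 / 3) / osc_step.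

Lemma jn_exponent_gt0 : 0 < jn_exponent.
Proof.
apply: divr_gt0; last exact: osc_step_gt0.
by apply: ln_gt0; lra.
Qed.

Lemma john_nirenberg o (s : R) : 0 < s ->
  (\int[mu]_(x in cube o s) (expR (jn_exponent * `|b x - c o s|))%:E <=
    16%:E * mu (cube o s))%E.
Proof.
move=> s0; have K0 := osc_step_gt0; set K := osc_step in K0.
set h := fun x => `|b x - c o s|; pose q : R := 4 / 3.
have q0 : 0 < q by rewrite /q; lra.
have mh : measurable_fun [set: 'rV[R]_n.+1] h by exact: measurable_distr.
have mQ : measurable (cube o s) by exact: measurable_box.
pose F j := [set x | K *+ j <= h x].
have mF j : measurable (F j) by exact: measurable_ge.
pose f j x := q ^+ j.+1 * \1_(F j) x.
have qj j : 0 <= q ^+ j.+1 by rewrite exprn_ge0// ltW.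
have f0 j x : 0 <= f j x by rewrite mulr_ge0.
have f0E j x : (0 <= (f j x)%:E)%E by rewrite lee_fin.
have mf j : measurable_fun [set: 'rV[R]_n.+1] (f j).
  by apply: measurable_funM => //; exact: measurable_indicRn.
have mfE j : measurable_fun (cube o s) (fun x => (f j x)%:E).
  exact: measurable_EFin_comp.
(* The term of index [j], the integer part of [h x / K], suffices. *)
have pw x : ((expR (jn_exponent * h x))%:E <= \sum_(j <oo) (f j x)%:E)%E.
  have hK0 : 0 <= h x / K by rewrite divr_ge0 ?normr_ge0 ?ltW.
  have /andP[j1 j2] := truncn_itv hK0; set j := Num.trunc _ in j1 j2.
  apply: le_trans (nneseries_ge_term j (fun k => f0E k x)).
  rewrite /f (_ : \1_(F j) x = 1 :> R); last first.
    by rewrite indicE mem_set// /F/= -mulr_natl -ler_pdivlMr.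
  rewrite mulr1 lee_fin -[in leRHS](lnK (x := q)) ?posrE// -expRM_natl ler_expR.
  rewrite /jn_exponent -/K mulrAC -mulrA -/q mulrC; apply: ler_wpM2r; last exact: ltW.
  by apply: ln_ge0; rewrite /q; lra.
apply: (@le_trans _ _ (\int[mu]_(x in cube o s) \sum_(j <oo) (f j x)%:E)%E).
  apply: ge0_le_integral.
  - exact: mQ.
  - by move=> x _; rewrite lee_fin expR_ge0.
  - apply: measurable_EFin_comp.
    apply: (measurableT_comp (@measurable_expR R)).
    exact: measurable_funM.
  - by apply: ge0_emeasurable_sum.
  - by move=> x _; exact: pw.
rewrite (@integral_nneseries _ _ _ mu _ mQ (fun j x => (f j x)%:E))//.
apply: (@le_trans _ _ (\sum_(j <oo) (mu (cube o s) * (16 / 3 * (2 / 3) ^+ j)%:E))%E).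
  apply: lee_nneseries => [j _ _|j _]; first exact: integral_ge0.
  rewrite (lebesgue_integralZl mQ (measurable_indicRn (mF j)))//.
  rewrite lebesgue_integral_indic//.
  apply: (@le_trans _ _ ((q ^+ j.+1)%:E * ((4 * 2^-1 ^+ j)%:E * mu (cube o s)))%E).
    by apply: lee_wpmul2l; [rewrite lee_fin|exact: osc_set_exp_decay].
  rewrite muleA muleC -EFinM.
  rewrite (_ : q ^+ j.+1 * _ = 16 / 3 * (2 / 3) ^+ j)//.
  rewrite (_ : 2 / 3 = q * 2^-1); last by rewrite /q; field.
  rewrite [(q / 2) ^+ j]exprMn [q ^+ j.+1]exprS.
  by move: (q ^+ j) (2^-1 ^+ j) => y z; rewrite /q; field.
rewrite lebesgue_cube// nneseriesZl; last first.
  by move=> j _; rewrite lee_fin mulr_ge0 ?exprn_ge0//; lra.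
rewrite nneseries_geometric; last by apply/andP; split; lra.
have -> : 16 / 3 / (1 - 2 / 3) = 16 :> R by field.
move: (_ ^+ _ * _) => p; rewrite -!EFinM lee_fin.
by rewrite mulrC.
Qed.

(** [young_LlogL] integrated, the exponential being summable by
    [john_nirenberg]. *)
Lemma osc_LlogL o (s a : R) (A : set 'rV[R]_n.+1) (g : 'rV[R]_n.+1 -> R) :
  0 < s -> 0 <= a -> measurable A -> A `<=` cube o s ->
  measurable_fun [set: 'rV[R]_n.+1] g -> (forall x, 0 <= g x) ->
  (\int[mu]_(x in A) (`|b x - c o s| * g x)%:E <=
    (a + 2 / jn_exponent)%:E * \int[mu]_(x in A) (Phi (g x))%:E +
    (64 / jn_exponent * expR (- (jn_exponent * a / 4)))%:E * mu (cube o s))%E.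
Proof.
move=> s0 a0 mA AQ mg g0; have ga0 := jn_exponent_gt0; set ga := jn_exponent in ga0 *.
have gi0 : 0 < ga^-1 by rewrite invr_gt0.
have mh : measurable_fun [set: 'rV[R]_n.+1] (fun x => `|b x - c o s|).
  exact: measurable_distr.
have mP := measurable_comp_Phi mg.
have mE : measurable_fun [set: 'rV[R]_n.+1] (fun x => expR (ga * `|b x - c o s|)).
  apply: (measurableT_comp (@measurable_expR R)); exact: measurable_funM.
have P0 x : 0 <= Phi (g x) by exact: Phi_ge0.
have E0 x : 0 <= expR (ga * `|b x - c o s|) by exact: expR_ge0.
have c10 : 0 <= a + 2 / ga by rewrite addr_ge0// mulr_ge0// ltW.
set e := 4 / ga * expR (- (ga * a / 4)).
have e0 : 0 <= e by rewrite !mulr_ge0 ?expR_ge0// ltW.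
have mcP : measurable_fun [set: 'rV[R]_n.+1] (fun x => (a + 2 / ga) * Phi (g x)).
  exact: measurable_funM.
have mcE : measurable_fun [set: 'rV[R]_n.+1]
    (fun x => e * expR (ga * `|b x - c o s|)).
  exact: measurable_funM.
apply: (@le_trans _ _ (\int[mu]_(x in A) ((a + 2 / ga) * Phi (g x) +
   e * expR (ga * `|b x - c o s|))%:E)%E).
  apply: lebesgue_le_integral.
  - exact: mA.
  - by apply: measurable_funM; [exact: mh|exact: mg].
  - by apply: measurable_funD; [exact: mcP|exact: mcE].
  - by move=> x; rewrite mulr_ge0.
  - by move=> x _; exact: young_LlogL.
rewrite lebesgue_integralD//; last 2 first.
- by move=> x; rewrite mulr_ge0.
- by move=> x; rewrite mulr_ge0.
rewrite !lebesgue_integralZl//; apply: leeD2l.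
apply: (@le_trans _ _ (e%:E * (16%:E * mu (cube o s)))%E).
  apply: lee_wpmul2l; first by rewrite lee_fin.
  apply: le_trans (john_nirenberg o s0); apply: lebesgue_subset_integral => //.
  exact: measurable_box.
rewrite muleA -EFinM (_ : e * 16 = 64 / ga * expR (- (ga * a / 4)))//.
rewrite /e; ring.
Qed.

(** A point where both oscillations are small exists because the exceptional
    sets together fill at most half of the smaller cube. *)
Lemma osc_center_double o o' (s : R) : 0 < s -> 0 < u ->
  cube o s `<=` cube o' (2 * s) ->
  `|c o s - c o' (2 * s)| <= 2 ^+ n.+4 * M.
Proof.
move=> s0 u0 ss; have t0 : (0 : R) < 2 ^+ n.+1 by rewrite exprn_gt0.
have s20 : 0 < 2 * s by rewrite mulr_gt0.
pose l := 2 ^+ n.+3 * M; have l0 : 0 < l by rewrite mulr_gt0// exprn_gt0.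
have [x [Qx x1 x2]] : exists x, [/\ cube o s x, `|b x - c o s| <= l &
    `|b x - c o' (2 * s)| <= l].
  apply: contrapT => H.
  have : (mu (cube o s) <= mu (osc_set o s l) + mu (osc_set o' (2 * s) l))%E.
    apply: le_trans (lebesgueU_le _ _); apply: le_lebesgue => x Qx.
    have [x1|x1] := lerP `|b x - c o s| l; last by left.
    right; split; first exact: ss.
    by rewrite /= ltNge; apply/negP => x2; apply: H; exists x.
  have := weak_osc o' s20 l0; have := weak_osc o s0 l0.
  rewrite -(fineK (osc_set_fin o l s0)) -(fineK (osc_set_fin o' l s20)).
  set w1 := fine _; set w2 := fine _.
  rewrite !lebesgue_cube// -!EFinM -!EFinD !lee_fin exprMn.
  have : 0 < s ^+ n.+1 * u by rewrite mulr_gt0// exprn_gt0.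
  rewrite -(mulrA (2 ^+ n.+1)); set p := s ^+ n.+1 * u => p0 H1 H2 H3.
  have w1l : l * w1 <= 4^-1 * (l * p).
    apply: (le_trans H1); rewrite /l 2!exprS.
    have : M * p <= 2 ^+ n.+1 * (M * p).
      by rewrite ler_peMl ?exprn_ege1 ?ler1n// mulr_ge0// ltW.
    have : 0 <= M * p by rewrite mulr_ge0// ltW.
    lra.
  have w2l : l * w2 <= 4^-1 * (l * p).
    apply: (le_trans H2); rewrite /l [2 ^+ n.+3]exprS [2 ^+ n.+2]exprS; lra.
  have := ler_wpM2l (ltW l0) H3; have := mulr_gt0 l0 p0; rewrite mulrDr; lra.
have := ler_normD (c o s - b x) (b x - c o' (2 * s)).
rewrite addrA subrK (distrC (c o s) (b x)) => H.
rewrite (_ : 2 ^+ n.+4 * M = l + l); last by rewrite /l [2 ^+ n.+4]exprS; ring.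
by apply: le_trans H _; exact: lerD.
Qed.

End john_nirenberg.

(** * Oscillation of BMO functions on cubes *)

Section bmo.
Context (R : realType) (n : nat).
Local Notation mu := (@lebesgue R n).
Local Notation u := (unit_cube_measure R n).
Variables (b : 'rV[R]_n.+1 -> R).

(** The mean over a ball that contains the cube and has comparable measure;
    this transfers the definition by balls to cubes. *)
Definition cube_center (o : 'rV[R]_n.+1) (s : R) : R :=
  ball_mean b o (n.+2%:R * s).

(** The power bounds the ratio of the measures of the ball of [cube_center] and
    of the cube; the [1] makes the bound positive also for constant [b]. *)
Definition bmo_bound : R := (fine (bmo_norm b) + 1) * (2 * n.+2%:R) ^+ n.+1.

Lemma bmo_norm_ge0 : (0 <= bmo_norm b)%E.
Proof.
apply: le_trans (ereal_sup_ubound _); last by exists 0, 1.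
by rewrite mule_ge0 ?integral_ge0// lee_fin invr_ge0 fine_ge0// lebesgue_ge0.
Qed.

Lemma bmo_bound_gt0 : 0 < bmo_bound.
Proof.
by rewrite mulr_gt0// ltr_wpDl// fine_ge0// bmo_norm_ge0.
Qed.

Lemma lebesgue_eball_le o (r : R) : 0 < r ->
  (mu (eball o r) <= ((2 * r) ^+ n.+1 * u)%:E)%E.
Proof.
move=> r0; rewrite -(lebesgue_cube (o - const_mx r)) ?mulr_gt0//.
exact/le_lebesgue/eball_sub_cube.
Qed.

Hypothesis b_bmo : BMO b.
Hypothesis u0 : 0 < u.

Lemma bmo_cube o (s : R) : 0 < s ->
  (\int[mu]_(x in cube o s) (`|b x - cube_center o s|)%:E <=
   bmo_bound%:E * mu (cube o s))%E.
Proof.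
move=> s0; have [[mb _] boo] := b_bmo.
pose r := n.+2%:R * s; have r0 : 0 < r by rewrite mulr_gt0.
have bfin : bmo_norm b \is a fin_num by rewrite ge0_fin_numE// bmo_norm_ge0.
have mh : measurable_fun [set: 'rV[R]_n.+1] (fun x => `|b x - cube_center o s|).
  exact: measurable_distr.
have QB : cube o s `<=` eball o r by exact: cube_sub_eball.
have Ble := lebesgue_eball_le o r0.
have Bfin : mu (eball o r) \is a fin_num.
  by rewrite ge0_fin_numE ?lebesgue_ge0// (le_lt_trans Ble)// ltry.
have B0 : 0 < fine (mu (eball o r)).
  rewrite -lte_fin fineK//; apply: lt_le_trans (le_lebesgue QB).
  by rewrite lebesgue_cube// lte_fin mulr_gt0// exprn_gt0.
have : ((fine (mu (eball o r)))^-1%:E *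
    \int[mu]_(y in eball o r) `|b y - ball_mean b o r|%:E <= bmo_norm b)%E.
  by apply: ereal_sup_ubound; exists o, r.
rewrite lee_pdivrMl// => H.
apply: (@le_trans _ _ (\int[mu]_(y in eball o r) `|b y - ball_mean b o r|%:E)%E).
  apply: lebesgue_subset_integral => //; [exact: measurable_box|].
  exact: measurable_eball.
apply: (le_trans H); rewrite lebesgue_cube// -(fineK bfin) -!EFinM lee_fin.
have {}Ble : fine (mu (eball o r)) <= (2 * n.+2%:R) ^+ n.+1 * (s ^+ n.+1 * u).
  by rewrite mulrA -exprMn -mulrA -lee_fin fineK.
rewrite mulrC /bmo_bound -[leRHS]mulrA ler_pM//.
- by rewrite fine_ge0// bmo_norm_ge0.
- exact: ltW.
- by rewrite lerDl.
Qed.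

Lemma bmo_weak_osc o (s l : R) : 0 < s -> 0 < l ->
  (l%:E * mu (osc_set b cube_center o s l) <= bmo_bound%:E * mu (cube o s))%E.
Proof.
move=> s0 l0; apply: le_trans (bmo_cube o s0).
have [[mb _] _] := b_bmo.
have mh := measurable_distr (cube_center o s) mb.
apply: lebesgue_markov => //; [exact: measurable_box| |exact: ltW|].
  exact: measurable_gt.
by move=> x /= /ltW.
Qed.

End bmo.

(** * Truncation and dyadic rings around a ball *)

Section truncation.
Context (R : realType) (n : nat).
Local Notation mu := (@lebesgue R n).
Implicit Types (f : 'rV[R]_n.+1 -> R) (A : set 'rV[R]_n.+1).

Lemma L1c_measurable f : L1c f -> measurable_fun [set: 'rV[R]_n.+1] f.
Proof. by move=> [/integrableP[mf _] _]; apply/measurable_EFinP. Qed.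

Lemma L1c_restrict f A : measurable A -> L1c f -> L1c (f \_ A).
Proof.
move=> mA [fi fc]; split.
  rewrite -restrict_EFin; apply/integrable_restrict => //.
  by rewrite setTI; exact: (integrableS _ _ _ fi).
apply: subclosed_compact fc _; first exact: closed_closure.
by apply: closure_subset => x /=; rewrite /patch; case: ifPn; rewrite ?eqxx.
Qed.

Lemma restrictDC f A x : (f \_ A) x + (f \_ (~` A)) x = f x.
Proof. by rewrite /patch in_setC; case: ifPn => _ /=; rewrite ?addr0 ?add0r. Qed.

(** The topology is that of the sup norm, so a sup ball of radius [r / n.+1]
    is used to separate [x] from the complement of the doubled ball. *)
Lemma supp_restrict_far f x0 (r : R) x : 0 < r -> eball x0 r x ->
  ~ supp (f \_ (~` eball x0 (2 * r))) x.
Proof.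
move=> r0 xr /(_ (ball x (r / n.+1%:R))) [].
  by apply: nbhsx_ballx; rewrite divr_gt0.
move=> y [/=]; rewrite /patch; case: ifPn; last by rewrite eqxx.
rewrite inE /eball/= => /negP; rewrite -leNgt => yB _ [_ xy].
have : enorm (y - x) <= n.+1%:R * (r / n.+1%:R).
  apply: enorm_le_coord => [|i]; first by rewrite ltW// divr_gt0.
  by have := xy 0 i; rewrite /ball/= !mxE distrC => /ltW.
rewrite mulrC divfK ?pnatr_eq0// => yx.
have := enorm_triangle x y x0; have := xr; rewrite /eball/=; lra.
Qed.

End truncation.

Section rings.
Context (R : realType) (n : nat) (x0 : 'rV[R]_n.+1) (r : R).
Hypothesis r0 : 0 < r.
Local Notation mu := (@lebesgue R n).
Implicit Types (x y : 'rV[R]_n.+1).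

Lemma dyadic_ring y : ~ eball x0 (2 * r) y -> exists k,
  2 ^+ k.+1 * r <= enorm (y - x0) /\ eball x0 (2 ^+ k.+2 * r) y.
Proof.
rewrite /eball/= => /negP; rewrite -leNgt; set e := enorm _ => re.
have ex : exists k, e < 2 ^+ k * r.
  exists (Num.trunc (e / r)).+1; rewrite -ltr_pdivrMr//.
  apply: (@lt_le_trans _ _ (Num.trunc (e / r)).+1%:R).
    by have /andP[] := truncn_itv (divr_ge0 (enorm_ge0 (y - x0)) (ltW r0)).
  by rewrite -natrX ler_nat ltnW// ltn_expl.
case: (ex_minnP ex) => -[|[|k]] ek km.
- by have := le_lt_trans re ek; rewrite ltr_pM2r// -natrX ltr_nat.
- by have := le_lt_trans re ek; rewrite ltr_pM2r// -natrX ltr_nat.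
- exists k; split => //; rewrite leNgt; apply/negP => /km.
  by rewrite ltnn.
Qed.

Lemma kernel_le x y k : eball x0 r x -> 2 ^+ k.+1 * r <= enorm (y - x0) ->
  (enorm (x - y) ^+ n.+1)^-1 <= ((2 ^+ k * r) ^+ n.+1)^-1.
Proof.
rewrite /eball/= => xr yk.
have k0 : 0 < 2 ^+ k * r by rewrite mulr_gt0// exprn_gt0.
have rk : r <= 2 ^+ k * r by apply: ler_peMl; rewrite ?exprn_ege1 ?ler1n// ltW.
have xy : 2 ^+ k * r <= enorm (x - y).
  have := enorm_triangle x y x0; rewrite (enorm_distrC y x).
  move: yk; rewrite exprS; lra.
have e0 : 0 < enorm (x - y) by exact: lt_le_trans xy.
by rewrite lef_pV2 ?posrE ?exprn_gt0// lerXn2r ?nnegrE// ltW.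
Qed.

Lemma measurable_kernel x :
  measurable_fun [set: 'rV[R]_n.+1] (fun y => (enorm (x - y) ^+ n.+1)^-1).
Proof.
(* At [y = x] both sides are 0. *)
rewrite (_ : (fun y => _) = (fun y => (enorm (y - x) ^+ n.+1) `^ (-1))).
  have mX : measurable_fun [set: 'rV[R]_n.+1] (fun y => enorm (y - x) ^+ n.+1).
    apply: measurable_funX; exact: measurable_enormB.
  exact: (measurableT_comp (@measurable_powR R (-1)) mX).
apply/funext => y; rewrite enorm_distrC powR_inv1// exprn_ge0//.
exact: enorm_ge0.
Qed.

(** On the ring between [2^(k+1) B] and [2^(k+2) B] the distance to a point of
    [B] is at least [2^k r]; the integral over the ring is then enlarged to
    [2^(k+2) B]. *)
Lemma far_integral_le (h : 'rV[R]_n.+1 -> R) x : eball x0 r x ->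
  measurable_fun [set: 'rV[R]_n.+1] h -> (forall y, 0 <= h y) ->
  (forall y, eball x0 (2 * r) y -> h y = 0) ->
  (\int[mu]_y (h y / enorm (x - y) ^+ n.+1)%:E <=
   \sum_(k <oo) (((2 ^+ k * r) ^+ n.+1)^-1%:E *
     \int[mu]_(y in eball x0 (2 ^+ k.+2 * r)) (h y)%:E))%E.
Proof.
move=> xr mh h0 hB.
pose w k : R := ((2 ^+ k * r) ^+ n.+1)^-1.
have w0 k : 0 <= w k by rewrite invr_ge0 exprn_ge0// mulr_ge0 ?exprn_ge0// ltW.
pose B k := eball x0 (2 ^+ k.+2 * r).
have mB k : measurable (B k) by exact: measurable_eball.
pose G k y := w k * (h y * \1_(B k) y).
have G0 k y : 0 <= G k y by rewrite !mulr_ge0.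
have G0E k y : (0 <= (G k y)%:E)%E by rewrite lee_fin.
have mhB k : measurable_fun [set: 'rV[R]_n.+1] (fun y => h y * \1_(B k) y).
  by apply: measurable_funM; [exact: mh|exact: measurable_indicRn].
have mG k : measurable_fun [set: 'rV[R]_n.+1] (fun y => (G k y)%:E).
  apply: measurable_EFin_comp; apply: measurable_funM; last exact: mhB.
  exact: measurable_cst.
have mK := measurable_kernel x.
apply: (@le_trans _ _ (\int[mu]_y \sum_(k <oo) (G k y)%:E)%E).
  apply: ge0_le_integral.
  - exact: measurableT.
  - move=> y _; rewrite lee_fin mulr_ge0// invr_ge0 exprn_ge0//.
    exact: enorm_ge0.
  - apply: measurable_EFin_comp.
    by apply: measurable_funM; [exact: mh|exact: mK].
  - by apply: ge0_emeasurable_sum => // k _; exact: mG.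
  move=> y _; have [yB|yB] := pselect (eball x0 (2 * r) y).
    by rewrite hB// mul0r nneseries_ge0// => k _ _; exact: G0E.
  have [k [k1 k2]] := dyadic_ring yB.
  apply: le_trans (nneseries_ge_term k (fun j => G0E j y)).
  rewrite lee_fin /G indicE mem_set// mulr1 mulrC.
  by rewrite ler_wpM2r// kernel_le.
rewrite (@integral_nneseries _ _ _ mu _ measurableT (fun k y => (G k y)%:E) mG)//.
apply: lee_nneseries => [k _ _|k _]; first exact: integral_ge0.
rewrite lebesgue_integralZl//; last by move=> y; rewrite mulr_ge0.
apply: lee_wpmul2l; first by rewrite lee_fin.
by rewrite (lebesgue_integral_indicM h (mB k)).
Qed.

End rings.

(** * The contribution of the far part *)

Section far.
Context (R : realType) (n : nat).
Local Notation mu := (@lebesgue R n).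
Local Notation u := (unit_cube_measure R n).
Variables (b : 'rV[R]_n.+1 -> R) (c : 'rV[R]_n.+1 -> R -> R) (M : R).
Hypothesis mb : measurable_fun [set: 'rV[R]_n.+1] b.
Hypothesis M0 : 0 < M.
Hypothesis u0 : 0 < u.
Hypothesis weak_osc : forall o (s l : R), 0 < s -> 0 < l ->
  (l%:E * mu (osc_set b c o s l) <= M%:E * mu (cube o s))%E.
Local Notation ga := (jn_exponent n M).
Local Notation L := (2 ^+ n.+4 * M).

(** The constant attached to the cube circumscribed to the ball. *)
Definition osc_center (x0 : 'rV[R]_n.+1) (r : R) : R :=
  c (x0 - const_mx r) (2 * r).

Lemma osc_center_chain x0 (r : R) k : 0 < r ->
  `|osc_center x0 r - osc_center x0 (2 ^+ k * r)| <= k%:R * L.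
Proof.
move=> r0; elim: k => [|k IH]; first by rewrite expr0 mul1r subrr normr0 mul0r.
have rk0 : 0 < 2 ^+ k * r by rewrite mulr_gt0// exprn_gt0.
have step : `|osc_center x0 (2 ^+ k * r) - osc_center x0 (2 ^+ k.+1 * r)| <= L.
  rewrite /osc_center [2 ^+ k.+1]exprS -[2 * 2 ^+ k * r]mulrA.
  apply: (osc_center_double M0 weak_osc) => //; first by rewrite mulr_gt0.
  move=> y yk i; move: (yk i); rewrite !in_itv/= !mxE => /andP[H1 H2].
  apply/andP; split; lra.
rewrite (_ : k.+1%:R * L = k%:R * L + L); last by rewrite -[k.+1%:R]natr1 mulrDl mul1r.
have := ler_normD (osc_center x0 r - osc_center x0 (2 ^+ k * r))
  (osc_center x0 (2 ^+ k * r) - osc_center x0 (2 ^+ k.+1 * r)).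
rewrite addrA subrK => /le_trans; apply; exact: lerD.
Qed.

(** Compare [b y] with the constant of the ball of integration for
    [osc_LlogL], and that constant with the one of the ball of radius [r] by
    the chain of doublings. *)
Lemma far_term (f : 'rV[R]_n.+1 -> R) (sigma : R) x0 (r a I : R) x k :
  0 < r -> 0 < sigma -> 0 <= a -> measurable_fun [set: 'rV[R]_n.+1] f ->
  (\int[mu]_(y in eball x0 (2 ^+ k * r)) (Phi (`|f y| / sigma))%:E <= I%:E)%E ->
  (\int[mu]_(y in eball x0 (2 ^+ k * r)) (`|b x - b y| * `|f y|)%:E <=
   (sigma * ((`|b x - osc_center x0 r| + k%:R * L + (a + 2 / ga)) * I +
     64 / ga * expR (- (ga * a / 4)) * ((2 * (2 ^+ k * r)) ^+ n.+1 * u)))%:E)%E.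
Proof.
move=> r0 s0 a0 mf HI; have rk0 : 0 < 2 ^+ k * r by rewrite mulr_gt0// exprn_gt0.
set m := osc_center x0 (2 ^+ k * r); set X := `|b x - _|.
set B := eball x0 _ in HI *.
have mB : measurable B by exact: measurable_eball.
pose g y := `|f y| / sigma.
have mnf : measurable_fun [set: 'rV[R]_n.+1] (fun y => `|f y|).
  exact: (measurableT_comp (@normr_measurable R setT) mf).
have mg : measurable_fun [set: 'rV[R]_n.+1] g by exact: measurable_funM.
have g0 y : 0 <= g y by rewrite divr_ge0// ltW.
have mP := measurable_comp_Phi mg.
have mo : measurable_fun [set: 'rV[R]_n.+1] (fun y => `|b y - m|).
  exact: measurable_distr.
have mog : measurable_fun [set: 'rV[R]_n.+1] (fun y => `|b y - m| * g y).
  exact: measurable_funM.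
have P0 y : 0 <= Phi (g y) by exact: Phi_ge0.
have ga0 : 0 < ga by exact: jn_exponent_gt0.
have XL : 0 <= X + k%:R * L.
  apply: addr_ge0; first exact: normr_ge0.
  apply: mulr_ge0; first exact: ler0n.
  by apply: mulr_ge0; [exact: exprn_ge0|exact: ltW].
have mXP : measurable_fun [set: 'rV[R]_n.+1] (fun y => (X + k%:R * L) * Phi (g y)).
  exact: measurable_funM.
have mS : measurable_fun [set: 'rV[R]_n.+1]
    (fun y => (X + k%:R * L) * Phi (g y) + `|b y - m| * g y).
  exact: measurable_funD.
apply: (@le_trans _ _ (\int[mu]_(y in B)
    (sigma * ((X + k%:R * L) * Phi (g y) + `|b y - m| * g y))%:E)%E).
  apply: lebesgue_le_integral.
  - exact: mB.
  - apply: measurable_funM; last exact: mnf.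
    apply: (measurableT_comp (@normr_measurable R setT)).
    exact: measurable_funB.
  - exact: measurable_funM.
  - by move=> y; rewrite mulr_ge0.
  move=> y _; have fg : `|f y| = sigma * g y by rewrite /g mulrC divfK// gt_eqF.
  rewrite fg mulrCA ler_pM2l//.
  have H : `|b x - b y| <= X + k%:R * L + `|b y - m|.
    have := osc_center_chain x0 k r0; rewrite -/m.
    have := ler_normD (b x - osc_center x0 r) (osc_center x0 r - m).
    have := ler_normD (b x - m) (m - b y).
    rewrite !addrA !subrK (distrC m) -/X; lra.
  apply: (@le_trans _ _ ((X + k%:R * L + `|b y - m|) * g y)).
    exact: ler_wpM2r.
  by rewrite mulrDl lerD2r ler_wpM2l// le_Phi.
rewrite lebesgue_integralZl//; last 2 first.
- by move=> y; rewrite addr_ge0// mulr_ge0.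
- exact: ltW.
rewrite EFinM; apply: lee_wpmul2l; first by rewrite lee_fin ltW.
rewrite lebesgue_integralD//; last 2 first.
- by move=> y; rewrite mulr_ge0.
- by move=> y; rewrite mulr_ge0.
rewrite lebesgue_integralZl// (_ : (_ + _ + (a + 2 / ga)) * I + _ =
  (X + k%:R * L) * I + ((a + 2 / ga) * I + 64 / ga * expR (- (ga * a / 4)) *
    ((2 * (2 ^+ k * r)) ^+ n.+1 * u))); last by ring.
rewrite [leRHS]EFinD; apply: leeD.
  by rewrite [leRHS]EFinM; apply: lee_wpmul2l; rewrite ?lee_fin.
apply: (le_trans (osc_LlogL mb M0 weak_osc _ a0 mB _ mg g0)).
- by rewrite mulr_gt0.
- exact: eball_sub_cube.
rewrite lebesgue_cube ?mulr_gt0// [leRHS]EFinD; apply: leeD; last by rewrite -EFinM.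
rewrite [leRHS]EFinM; apply: lee_wpmul2l => //.
by rewrite lee_fin addr_ge0// divr_ge0// ltW.
Qed.

(** The parameter [a + k] grows with [k]: it turns the exponential terms, whose
    coefficients [8 ^+ n.+1] do not decay, into a geometric series, while the
    linear growth it causes in the other terms is absorbed by [q]. *)
Lemma far_term_geometric (D q V X a : R) (r : R) k :
  0 < r -> 0 < D -> 0 <= V -> 0 <= X -> 0 <= a ->
  D / 2 ^+ n.+1 < q -> q < 1 ->
  ((2 ^+ k * r) ^+ n.+1)^-1 *
    ((X + k.+2%:R * L + (a + k%:R + 2 / ga)) * (D ^+ k.+2 * V) +
     64 / ga * expR (- (ga * (a + k%:R) / 4)) * ((2 * (2 ^+ k.+2 * r)) ^+ n.+1 * u))
  <= D ^+ 2 * (V / r ^+ n.+1) *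
      (X + (2 * L + 1 + 2 / ga) * (q / (q - D / 2 ^+ n.+1)) * (1 + a)) * q ^+ k +
    64 / ga * 8 ^+ n.+1 * u * expR (- (ga * a / 4)) * expR (- (ga / 4)) ^+ k.
Proof.
move=> r0 D0 V0 X0 a0 q0q q1.
have ga0 : 0 < ga by exact: jn_exponent_gt0.
have L0 : 0 <= L by apply: mulr_ge0; [exact: exprn_ge0|exact: ltW].
set q0 := D / 2 ^+ n.+1 in q0q *.
have q00 : 0 <= q0 by rewrite divr_ge0 ?exprn_ge0// ltW.
set W := q / (q - q0); set e := expR (- (ga * a / 4)).
have rN : r ^+ n.+1 != 0 by rewrite expf_neq0// gt_eqF.
have tk : (2 : R) ^+ k != 0 by rewrite expf_neq0.
have tN : (2 : R) ^+ n.+1 != 0 by rewrite expf_neq0.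
rewrite mulrDr; apply: lerD.
  have -> : ((2 ^+ k * r) ^+ n.+1)^-1 * ((X + k.+2%:R * L + (a + k%:R + 2 / ga)) *
      (D ^+ k.+2 * V)) = D ^+ 2 * (V / r ^+ n.+1) *
      ((X + k.+2%:R * L + (a + k%:R + 2 / ga)) * q0 ^+ k).
    rewrite /q0 expr_div_n (exprMn _ (2 ^+ k)) (exprAC 2).
    rewrite [D ^+ k.+2]exprS [D ^+ k.+1]exprS.
    have tNk : (2 ^+ n.+1 : R) ^+ k != 0 by rewrite expf_neq0.
    move: (2 ^+ n.+1 ^+ k) (r ^+ n.+1) (D ^+ k) tNk rN => y z w y0 z0.
    by field; rewrite y0 z0 gt_eqF.
  rewrite -[leRHS]mulrA; apply: ler_wpM2l.
    by rewrite mulr_ge0 ?exprn_ge0 ?divr_ge0 ?exprn_ge0// ltW.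
  have qk : q0 ^+ k <= q ^+ k by rewrite lerXn2r ?nnegrE// ltW// (le_lt_trans q00).
  have qk0 : 0 <= q0 ^+ k by rewrite exprn_ge0.
  have Wk := natS_exp_le k q00 q0q q1; rewrite -/W in Wk.
  set g := 2 * L + 1 + 2 / ga.
  have i0 : 0 <= 2 / ga by rewrite divr_ge0// ltW.
  have g0 : 0 <= g by rewrite !addr_ge0// mulr_ge0.
  apply: (@le_trans _ _ (X * q0 ^+ k + g * (1 + a) * (k.+1%:R * q0 ^+ k))).
    rewrite (_ : X * _ + _ = (X + g * (1 + a) * k.+1%:R) * q0 ^+ k); last by ring.
    apply: ler_wpM2r => //; rewrite -addrA lerD2l.
    have k0 : 0 <= k%:R :> R by [].
    have k2 : k.+2%:R = k%:R + 2 :> R by rewrite -addn2 natrD.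
    have k1 : k.+1%:R = k%:R + 1 :> R by rewrite -natr1.
    rewrite k2 k1 /g.
    have := mulr_ge0 L0 k0; have := mulr_ge0 i0 k0; have := mulr_ge0 a0 k0.
    have := mulr_ge0 L0 a0; have := mulr_ge0 i0 a0.
    have := mulr_ge0 (mulr_ge0 L0 a0) k0; have := mulr_ge0 (mulr_ge0 i0 a0) k0.
    move: (2 / ga) L k%:R i0 L0 k0 => y z w *; lra.
  rewrite [leRHS]mulrDl; apply: lerD; first exact: ler_wpM2l.
  rewrite (_ : g * W * (1 + a) * q ^+ k = g * (1 + a) * (W * q ^+ k)); last by ring.
  by rewrite ler_wpM2l// mulr_ge0// addr_ge0.
rewrite (_ : 2 * (2 ^+ k.+2 * r) = 8 * (2 ^+ k * r)); last by rewrite 2!exprS; ring.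
rewrite (_ : expR (- (ga * (a + k%:R) / 4)) = e * expR (- (ga / 4)) ^+ k); last first.
  by rewrite -expRM_natl -expRD; congr expR; field.
rewrite [(8 * _) ^+ _]exprMn.
have : (2 ^+ k * r) ^+ n.+1 != 0 by rewrite expf_neq0// mulf_neq0// gt_eqF.
move: ((2 ^+ k * r) ^+ n.+1) (expR (- (ga / 4)) ^+ k) (8 ^+ n.+1) => y z w y0.
rewrite le_eqVlt; apply/orP; left; apply/eqP; field.
by rewrite y0 gt_eqF.
Qed.

(** The constants are independent of [a], which is chosen later in terms of
    them. *)
Lemma far_bound (D : R) : 0 < D -> D < 2 ^+ n.+1 -> exists S1 S2 A : R,
  [/\ 0 <= S1, 0 <= S2, 0 <= A & forall (f : 'rV[R]_n.+1 -> R) (sigma : R) x0 (r a V : R) x,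
    0 < r -> 0 < sigma -> 0 <= a -> 0 <= V ->
    measurable_fun [set: 'rV[R]_n.+1] f ->
    (forall k, (\int[mu]_(y in eball x0 (2 ^+ k * r)) (Phi (`|f y| / sigma))%:E <=
       (D ^+ k * V)%:E)%E) ->
    eball x0 r x ->
    (\int[mu]_y (`|b x - b y| * `|(f \_ (~` eball x0 (2 * r))) y| /
        enorm (x - y) ^+ n.+1)%:E <=
     (sigma * (S1 * (V / r ^+ n.+1) * (`|b x - osc_center x0 r| + A * (1 + a)) +
        S2 * expR (- (ga * a / 4))))%:E)%E].
Proof.
move=> D0 D2; have ga0 : 0 < ga by exact: jn_exponent_gt0.
have t0 : (0 : R) < 2 ^+ n.+1 by rewrite exprn_gt0.
set q0 := D / 2 ^+ n.+1; pose q := (1 + q0) / 2; pose p := expR (- (ga / 4)).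
have q00 : 0 < q0 by rewrite divr_gt0.
have q01 : q0 < 1 by rewrite ltr_pdivrMr// mul1r.
have q0q : q0 < q by rewrite /q; lra.
have q1 : q < 1 by rewrite /q; lra.
have qge0 : 0 <= q by rewrite /q; lra.
have p1 : p < 1 by rewrite expR_lt1 oppr_lt0 divr_gt0.
have p0 : 0 <= p by exact: expR_ge0.
have L0 : 0 <= L by apply: mulr_ge0; [exact: exprn_ge0|exact: ltW].
have i0 : 0 <= ga^-1 by rewrite invr_ge0 ltW.
pose A := (2 * L + 1 + 2 / ga) * (q / (q - q0)).
have A0 : 0 <= A.
  apply: mulr_ge0; last by apply: divr_ge0 => //; lra.
  by have := mulr_ge0 (ltW (ltr0n R 2)) i0; lra.
have H0 : 0 <= 64 / ga * 8 ^+ n.+1 * u.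
  by rewrite !mulr_ge0// ltW.
exists (D ^+ 2 / (1 - q)), (64 / ga * 8 ^+ n.+1 * u / (1 - p)), A; split => //.
- by rewrite divr_ge0 ?exprn_ge0 ?subr_ge0// ltW.
- by rewrite divr_ge0// subr_ge0 ltW.
move=> f sigma x0 r a V x r0 s0 a0 V0 mf HV xr.
set X := `|b x - _|; set f2 := f \_ _; set e := expR (- (ga * a / 4)).
have X0 : 0 <= X by exact: normr_ge0.
have mB (rho : R) : measurable (eball x0 rho) by exact: measurable_eball.
have mf2 : measurable_fun [set: 'rV[R]_n.+1] f2.
  apply/(@measurable_restrictT _ _ _ _ (~` eball x0 (2 * r))).
    by apply: measurableC; exact: mB.
  exact: measurable_funTS.
have mbx : measurable_fun [set: 'rV[R]_n.+1] (fun y => `|b x - b y|).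
  apply: (measurableT_comp (@normr_measurable R setT)).
  exact: measurable_funB.
have mnf : measurable_fun [set: 'rV[R]_n.+1] (fun y => `|f y|).
  exact: (measurableT_comp (@normr_measurable R setT) mf).
have mnf2 : measurable_fun [set: 'rV[R]_n.+1] (fun y => `|f2 y|).
  exact: (measurableT_comp (@normr_measurable R setT) mf2).
have mh : measurable_fun [set: 'rV[R]_n.+1] (fun y => `|b x - b y| * `|f2 y|).
  by apply: measurable_funM; [exact: mbx|exact: mnf2].
have mh' : measurable_fun [set: 'rV[R]_n.+1] (fun y => `|b x - b y| * `|f y|).
  by apply: measurable_funM; [exact: mbx|exact: mnf].
have h0 y : 0 <= `|b x - b y| * `|f2 y| by rewrite mulr_ge0.
have hB y : eball x0 (2 * r) y -> `|b x - b y| * `|f2 y| = 0.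
  by move=> yB; rewrite /f2 /patch in_setC mem_set//= normr0 mulr0.
apply: (le_trans (far_integral_le r0 xr mh h0 hB)).
pose P := D ^+ 2 * (V / r ^+ n.+1) * (X + A * (1 + a)).
pose E := 64 / ga * 8 ^+ n.+1 * u * e.
have P0 : 0 <= P.
  rewrite /P; apply: mulr_ge0; first by rewrite mulr_ge0 ?divr_ge0 ?exprn_ge0// ltW.
  by rewrite addr_ge0// mulr_ge0// addr_ge0.
have E0 : 0 <= E by rewrite /E; apply: mulr_ge0 => //; exact: expR_ge0.
apply: (@le_trans _ _ (\sum_(k <oo) ((sigma * P * q ^+ k)%:E +
    (sigma * E * p ^+ k)%:E))%E).
  apply: lee_nneseries => [k _ _|k _].
    apply: mule_ge0; last by apply: integral_ge0 => y _; rewrite lee_fin.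
    by rewrite lee_fin invr_ge0 exprn_ge0// mulr_ge0 ?exprn_ge0// ltW.
  have w0 : 0 <= ((2 ^+ k * r) ^+ n.+1)^-1.
    by rewrite invr_ge0 exprn_ge0// mulr_ge0 ?exprn_ge0// ltW.
  have ak0 : 0 <= a + k%:R by rewrite addr_ge0.
  apply: (@le_trans _ _ (((2 ^+ k * r) ^+ n.+1)^-1%:E *
      \int[mu]_(y in eball x0 (2 ^+ k.+2 * r)) (`|b x - b y| * `|f y|)%:E)%E).
    apply: lee_wpmul2l; first by rewrite lee_fin.
    apply: lebesgue_le_integral.
    - exact: mB.
    - exact: mh.
    - exact: mh'.
    - exact: h0.
    move=> y _; apply: ler_wpM2l => //; rewrite /f2 /patch.
    by case: ifPn => //; rewrite normr0.
  have H := far_term x r0 s0 ak0 mf (HV k.+2).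
  apply: (@le_trans _ _ _ _ _ (lee_wpmul2l _ H)); first by rewrite lee_fin.
  rewrite -EFinM -EFinD lee_fin mulrCA.
  rewrite (_ : sigma * P * _ + _ = sigma * (P * q ^+ k + E * p ^+ k)); last by ring.
  apply: ler_wpM2l; first exact: ltW.
  exact: (far_term_geometric k r0 D0 V0 X0 a0 q0q q1).
rewrite nneseriesD; last 2 first.
- by move=> k _ _; rewrite lee_fin mulr_ge0 ?exprn_ge0// mulr_ge0// ltW.
- by move=> k _ _; rewrite lee_fin mulr_ge0 ?exprn_ge0// mulr_ge0// ltW.
rewrite nneseries_geometric ?qge0// nneseries_geometric ?p0// -EFinD lee_fin.
rewrite le_eqVlt; apply/orP; left; apply/eqP; rewrite /P /E.
have q1' : 1 - q != 0 by rewrite subr_eq0 gt_eqF.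
have p1' : 1 - p != 0 by rewrite subr_eq0 gt_eqF.
have rN : r ^+ n.+1 != 0 by rewrite expf_neq0// gt_eqF.
move: (8 ^+ n.+1) (r ^+ n.+1) (A) rN => y z w rN; field.
by rewrite p1' q1' rN gt_eqF.
Qed.

End far.

(** * The weak-type estimate *)

Local Ltac nonneg := repeat first [ done | by apply: ltW | apply: mulr_ge0
  | apply: addr_ge0 | rewrite invr_ge0 | apply: exprn_ge0 ].

Lemma doubling_iter (R : realType) (Theta : R -> R) (D : R) (k : nat) (r : R) :
  0 < r -> 0 < D -> (forall s, 0 < s -> Theta (2 * s) <= D * Theta s) ->
  Theta (2 ^+ k * r) <= D ^+ k * Theta r.
Proof.
move=> r0 D0 HD; elim: k => [|k IH]; first by rewrite !expr0 !mul1r.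
rewrite [2 ^+ k.+1]exprS -mulrA (le_trans (HD _ _)) ?mulr_gt0 ?exprn_gt0//.
by rewrite [D ^+ k.+1]exprS -mulrA ler_pM2l.
Qed.

(** The case of finite Morrey supremum, with the two regimes [tau <= eps] and
    [eps < tau] described at the top; the three parts [Ca], [Cb], [Cc] of the
    constant come from the regime [eps < tau], from the near part and from
    the far part. *)
Lemma weak_estimate_ball (R : realType) (n : nat) (b : 'rV[R]_n.+1 -> R)
    (bT : ('rV[R]_n.+1 -> R) -> 'rV[R]_n.+1 -> R)
    (c2 : R) (Theta : R -> R) (D : R) (C0 : R) :
  BMO b ->
  (forall f g, L1c f -> L1c g -> forall x,
    `|bT (fun y => f y + g y) x| <= `|bT f x| + `|bT g x|) ->
  commutator_size_bound b bT c2 ->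
  (forall r : R, 0 < r -> 0 < Theta r) ->
  0 < D < 2 ^+ n.+1 ->
  (forall r : R, 0 < r -> Theta (2 * r) <= D * Theta r) ->
  (forall (sigma : R) f, 0 < sigma -> L1c f ->
    (lebesgue [set x | (sigma < `|bT f x|)%R] <=
      C0%:E * \int[lebesgue]_x (Phi (`|f x| / sigma))%:E)%E) ->
  exists C : R, 0 < C /\
    forall f (sigma : R) (x0 : 'rV[R]_n.+1) (r m : R),
      L1c f -> 0 < sigma -> 0 < r -> 0 <= m ->
      (forall rho : R, 0 < rho ->
        (\int[lebesgue]_(x in eball x0 rho) (Phi (`|f x| / sigma))%:E <=
          (Theta rho * m)%:E)%E) ->
      (lebesgue (eball x0 r `&` [set x | (sigma < `|bT f x|)%R]) <=
        (C * (Theta r * m))%:E)%E.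
Proof.
move=> b_bmo subT sizeT Theta0 /andP[D0 D2] ThetaD weakT.
have [[mb _] _] := b_bmo.
set u := unit_cube_measure R n.
(* If the unit cube were null, so would be every ball. *)
have [u0|u0] := eqVneq u 0.
  exists 1; split=> // f sigma x0 r m _ s0 r0 m0 _.
  apply: (@le_trans _ _ 0%E); last by rewrite lee_fin mul1r mulr_ge0// ?ltW// Theta0.
  apply: (@le_trans _ _ (lebesgue (eball x0 r))); first by apply: le_lebesgue => x [].
  by apply: (le_trans (lebesgue_eball_le x0 r0)); rewrite -/u u0 mulr0.
have {}u0 : 0 < u by rewrite lt_def u0 unit_cube_measure_ge0.
set M := bmo_bound b; have M0 : 0 < M by exact: bmo_bound_gt0.
have weak_osc := bmo_weak_osc b_bmo u0.
have [S1 [S2 [A [S10 S20 A0 far]]]] := far_bound mb M0 u0 weak_osc D0 D2.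
have ga0 : 0 < jn_exponent n M by exact: jn_exponent_gt0.
set ga := jn_exponent n M in ga0 far.
set K := `|c2|; have K0 : 0 <= K by exact: normr_ge0.
pose a := 32 * (K * S2) / ga.
have KS : 0 <= K * S2 by exact: mulr_ge0.
have a0 : 0 <= a by apply: divr_ge0; [exact: mulr_ge0|exact: ltW].
(* [exp t >= 1 + t] at [t = 8 * (K * S2)] explains the choice of [a]. *)
have Ka : K * S2 * expR (- (ga * a / 4)) <= 8^-1.
  have -> : ga * a / 4 = 8 * (K * S2) by rewrite /a; field; rewrite gt_eqF.
  rewrite expRN ler_pdivrMr ?expR_gt0//.
  have := expR_ge1Dx (8 * (K * S2)); lra.
pose B := K * S1 * (A * (1 + a)).
have B0 : 0 <= B by nonneg.
pose eps := (8 * (1 + B))^-1.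
have eps0 : 0 < eps by rewrite invr_gt0 mulr_gt0//; lra.
have Beps : B * eps <= 8^-1.
  rewrite /eps ler_pdivrMr; last by rewrite mulr_gt0//; lra.
  lra.
have t0 : (0 : R) < 2 ^+ n.+1 by rewrite exprn_gt0.
have Ca0 : 0 <= 2 ^+ n.+1 * u / eps by nonneg.
have Cb0 : 0 <= 4 * `|C0| * D by nonneg.
have Cc0 : 0 <= 4 * (K * S1) * M * (2 ^+ n.+1 * u) by nonneg.
exists (2 ^+ n.+1 * u / eps + 4 * `|C0| * D + 4 * (K * S1) * M * (2 ^+ n.+1 * u) + 1).
set Ca := 2 ^+ n.+1 * u / eps in Ca0 *; set Cb := 4 * `|C0| * D in Cb0 *.
set Cc := 4 * (K * S1) * M * _ in Cc0 *.
split=> [|f sigma x0 r m fL s0 r0 m0 Hm]; first by lra.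
have Tr0 := Theta0 r r0; set V := Theta r * m.
have V0 : 0 <= V by nonneg.
have rN0 : 0 < r ^+ n.+1 by rewrite exprn_gt0.
pose tau := V / r ^+ n.+1.
have tau0 : 0 <= tau by nonneg.
have Vtau : V = tau * r ^+ n.+1 by rewrite divfK// gt_eqF.
have mB (rho : R) : measurable (eball x0 rho) by exact: measurable_eball.
have [tau_eps|eps_tau] := lerP tau eps; last first.
  apply: (@le_trans _ _ (lebesgue (eball x0 r))); first by apply: le_lebesgue => x [].
  apply: (le_trans (lebesgue_eball_le x0 r0)); rewrite lee_fin -/u.
  apply: (@le_trans _ _ (Ca * V)); last by rewrite ler_wpM2r//; lra.
  rewrite /Ca Vtau exprMn.
  have -> : 2 ^+ n.+1 * u / eps * (tau * r ^+ n.+1) =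
    2 ^+ n.+1 * r ^+ n.+1 * u * (tau / eps) by ring.
  rewrite ler_peMr//; first by rewrite !mulr_ge0// ?ltW.
  by rewrite ler_pdivlMr// mul1r ltW.
set B2 := eball x0 (2 * r); pose f1 := f \_ B2; pose f2 := f \_ (~` B2).
have mB2 : measurable B2 by exact: measurable_eball.
have f1L : L1c f1 by exact: L1c_restrict.
have f2L : L1c f2 by apply: L1c_restrict => //; exact: measurableC.
have mf := L1c_measurable fL; have mf1 := L1c_measurable f1L.
have fE : f = (fun y => f1 y + f2 y) by apply/funext => y; rewrite restrictDC.
set m0' := osc_center (cube_center b) x0 r.
have HV k : (\int[lebesgue]_(y in eball x0 (2 ^+ k * r)) (Phi (`|f y| / sigma))%:E <=
    (D ^+ k * V)%:E)%E.
  apply: (le_trans (Hm _ _)); first by rewrite mulr_gt0// exprn_gt0.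
  by rewrite lee_fin mulrA ler_wpM2r// doubling_iter.
pose F x := K * S1 * tau * `|b x - m0'|.
have F0 x : 0 <= F x by nonneg.
have mF : measurable_fun [set: 'rV[R]_n.+1] F.
  apply: measurable_funM; first exact: measurable_cst.
  exact: measurable_distr.
have mFge : measurable [set x | 4^-1 <= F x] by exact: measurable_ge.
have incl : eball x0 r `&` [set x | sigma < `|bT f x|] `<=`
    [set x | sigma / 2 < `|bT f1 x|] `|` (cube (x0 - const_mx r) (2 * r) `&`
      [set x | 4^-1 <= F x]).
  move=> x [xr /= xs]; have [T1|T1] := ltrP (sigma / 2) `|bT f1 x|; first by left.
  right; split; first exact: eball_sub_cube.
  rewrite fE in xs; have T12 := subT _ _ f1L f2L x.
  have xsupp : ~ supp f2 x by exact: supp_restrict_far.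
  have T2 := sizeT f2 f2L x xsupp.
  have far2 := far f sigma x0 r a V x r0 s0 a0 V0 mf HV xr.
  rewrite -/f2 -/tau -/m0' in far2.
  have {}T2 : `|bT f2 x| <= K * (sigma * (S1 * tau * (`|b x - m0'| + A * (1 + a)) +
      S2 * expR (- (ga * a / 4)))).
    rewrite -lee_fin (le_trans T2)// EFinM.
    apply: (@le_trans _ _ (K%:E * \int[lebesgue]_y
      (`|b x - b y| * `|f2 y| / enorm (x - y) ^+ n.+1)%:E)%E).
      apply: lee_wpmul2r; last by rewrite lee_fin ler_norm.
      apply: integral_ge0 => y _; rewrite lee_fin divr_ge0 ?mulr_ge0//.
      by rewrite exprn_ge0// enorm_ge0.
    by apply: lee_wpmul2l; rewrite ?lee_fin.
  rewrite leNgt; apply/negP => FX.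
  have : sigma * 2^-1 < sigma * (F x + B * tau + K * S2 * expR (- (ga * a / 4))).
    rewrite [ltRHS](_ : _ = K * (sigma * (S1 * tau * (`|b x - m0'| + A * (1 + a)) +
      S2 * expR (- (ga * a / 4))))); last by rewrite /F /B; ring.
    by apply: lt_le_trans T2; lra.
  rewrite ltr_pM2l//; have : B * tau <= B * eps by rewrite ler_wpM2l.
  lra.
apply: (le_trans (le_lebesgue incl)); apply: (le_trans (lebesgueU_le _ _)).
have part1 : (lebesgue [set x | (sigma / 2 < `|bT f1 x|)%R] <= (Cb * V)%:E)%E.
  have s20 : 0 < sigma / 2 by rewrite divr_gt0.
  apply: (le_trans (weakT _ _ s20 f1L)).
  pose g (y : 'rV[R]_n.+1) : R := `|f y| / sigma.
  have g0 y : 0 <= g y by rewrite divr_ge0// ?ltW.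
  have mg : measurable_fun [set: 'rV[R]_n.+1] g.
    apply: measurable_funM; last exact: measurable_cst.
    exact: (measurableT_comp (@normr_measurable R setT) mf).
  have mg1 : measurable_fun [set: 'rV[R]_n.+1] (fun y => `|f1 y| / (sigma / 2)).
    apply: measurable_funM; last exact: measurable_cst.
    exact: (measurableT_comp (@normr_measurable R setT) mf1).
  have mP := measurable_comp_Phi mg; have mP1 := measurable_comp_Phi mg1.
  have mPB : measurable_fun [set: 'rV[R]_n.+1] (fun y => Phi (g y) * \1_B2 y).
    by apply: measurable_funM; [exact: mP|exact: measurable_indicRn].
  have PB0 y : 0 <= Phi (g y) * \1_B2 y by rewrite mulr_ge0// Phi_ge0.
  have I1 : (\int[lebesgue]_y (Phi (`|f1 y| / (sigma / 2)))%:E <= (4 * (D * V))%:E)%E.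
    apply: (@le_trans _ _ (\int[lebesgue]_y (4 * (Phi (g y) * \1_B2 y))%:E)%E).
      apply: lebesgue_le_integral.
      - exact: measurableT.
      - exact: mP1.
      - by apply: measurable_funM; [exact: measurable_cst|exact: mPB].
      - by move=> y; apply: Phi_ge0; rewrite divr_ge0// ?ltW.
      move=> y _; rewrite /f1 /patch indicE; case: ifPn => _.
        rewrite mulr1 (_ : `|f y| / (sigma / 2) = 2 * g y); first exact: Phi_double.
        by rewrite /g; field; rewrite gt_eqF.
      by rewrite normr0 mul0r Phi0 !mulr0.
    rewrite lebesgue_integralZl// lebesgue_integral_indicM//.
    rewrite EFinM; apply: lee_wpmul2l => //.
    by have := HV 1%N; rewrite !expr1.
  apply: (@le_trans _ _ (`|C0|%:E * (4 * (D * V))%:E)%E); last first.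
    by rewrite -EFinM lee_fin /Cb le_eqVlt; apply/orP; left; apply/eqP; ring.
  apply: (@le_trans _ _ (`|C0|%:E *
      \int[lebesgue]_y (Phi (`|f1 y| / (sigma / 2)))%:E)%E).
    apply: lee_wpmul2r; last by rewrite lee_fin ler_norm.
    apply: integral_ge0 => y _; rewrite lee_fin Phi_ge0// divr_ge0// ?ltW//.
  by apply: lee_wpmul2l; rewrite ?lee_fin.
have part2 : (lebesgue (cube (x0 - const_mx r) (2 * r)%R `&`
    [set x | (4^-1 <= F x)%R])
    <= (Cc * V)%:E)%E.
  have r20 : 0 < 2 * r by rewrite mulr_gt0.
  have mQ : measurable (cube (x0 - const_mx r) (2 * r)) by exact: measurable_box.
  have q0 : 0 <= 4^-1 :> R by [].
  have := lebesgue_markov mQ mFge q0 mF F0 (fun x H => H).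
  rewrite lee_pdivrMl// => /le_trans; apply.
  have KSt : 0 <= K * S1 * tau by nonneg.
  rewrite (lebesgue_integralZl mQ (measurable_distr m0' mb) _ KSt)//.
  apply: (@le_trans _ _ (4%:E * ((K * S1 * tau)%:E *
      (M%:E * lebesgue (cube (x0 - const_mx r) (2 * r)))))%E).
    apply: lee_wpmul2l => //; apply: lee_wpmul2l; first by rewrite lee_fin.
    exact: bmo_cube.
  rewrite lebesgue_cube// -!EFinM lee_fin le_eqVlt; apply/orP; left; apply/eqP.
  by rewrite /Cc Vtau exprMn -/u; ring.
apply: (le_trans (leeD part1 part2)); rewrite -EFinD lee_fin.
have := mulr_ge0 Ca0 V0; lra.
Qed.

Theorem theorem1p2 (R : realType) (n : nat) (b : 'rV[R]_n.+1 -> R)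
    (bT : ('rV[R]_n.+1 -> R) -> 'rV[R]_n.+1 -> R)
    (c2 : R) (Theta : R -> R) (D : R) (C0 : nat -> R -> R -> R) :
  BMO b ->
  (forall f, L1c f -> measurable_fun setT (bT f)) ->
  linear_op bT \/ sublinear_op bT ->
  commutator_size_bound b bT c2 ->
  (forall r : R, 0 < r -> 0 < Theta r) ->
  (forall r s : R, 0 < r -> r <= s -> Theta r <= Theta s) ->
  0 < D < 2 ^+ n.+1 ->
  (forall r : R, 0 < r -> Theta (2 * r) <= D * Theta r) ->
  (forall (sigma : R) f, 0 < sigma -> L1c f ->
    (lebesgue [set x | (sigma < `|bT f x|)%R] <=
      (C0 n.+1 D (fine (bmo_norm b)))%:E *
      \int[lebesgue]_x (Phi (`|f x| / sigma))%:E)%E) ->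
  exists C : R, 0 < C /\
    forall f (sigma : R) (x0 : 'rV[R]_n.+1) (r : R),
      L1c f -> 0 < sigma -> 0 < r ->
      ((Theta r)^-1%:E * lebesgue (eball x0 r `&` [set x | (sigma < `|bT f x|)%R])
        <= C%:E * morrey_Phi Theta f sigma)%E.
Proof.
move=> b_bmo _ linT sizeT Theta0 _ D02 ThetaD weakT.
have subT f g : L1c f -> L1c g -> forall x,
    `|bT (fun y => f y + g y) x| <= `|bT f x| + `|bT g x|.
  move=> fL gL x; case: linT => [lT|]; last exact.
  have := lT 1 f g fL gL x; rewrite mul1r.
  rewrite (_ : (fun y => 1 * f y + g y) = (fun y => f y + g y)).
    by move=> ->; exact: ler_normD.
  by apply/funext => y; rewrite mul1r.
have [C [C0' HC]] := weak_estimate_ball b_bmo subT sizeT Theta0 D02 ThetaD weakT.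
exists C; split=> // f sigma x0 r fL s0 r0.
have Phi_int y (rho : R) : 0 < rho -> ((Theta rho)^-1%:E *
    \int[lebesgue]_(x in eball y rho) (Phi (`|f x| / sigma))%:E <=
    morrey_Phi Theta f sigma)%E.
  by move=> rho0; apply: ereal_sup_ubound; exists y, rho.
have morrey0 : (0 <= morrey_Phi Theta f sigma)%E.
  apply: le_trans (Phi_int x0 r r0); apply: mule_ge0.
    by rewrite lee_fin invr_ge0 ltW// Theta0.
  by apply: integral_ge0 => x _; rewrite lee_fin Phi_ge0// divr_ge0// ?ltW.
(* An infinite supremum gives an infinite right-hand side, as [C > 0]. *)
have [->|Mfin] := eqVneq (morrey_Phi Theta f sigma) +oo%E.
  by rewrite gt0_muley ?lte_fin// leey.
have {}Mfin : morrey_Phi Theta f sigma \is a fin_num.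
  by rewrite ge0_fin_numE// ltey.
rewrite -(fineK Mfin) in Phi_int morrey0 *; rewrite lee_fin in morrey0.
rewrite lee_pdivrMl ?Theta0// -!EFinM mulrCA.
apply: HC => // rho rho0; rewrite EFinM -lee_pdivrMl ?Theta0//.
exact: Phi_int.
Qed.
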